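(* Let $\omega$ be a non-principal ultrafilter on $\mathbb N$ and let $\big((X_i,d_i,\mathfrak m_i,p_i)\big)_{i\in\mathbb N}$ be an asymptotically boundedly $\mathfrak m_\omega$-totally bounded sequence of pointed Polish metric measure spaces with boundedly finite measures, with ultralimit $(X_\omega,d_\omega,\mathfrak m_\omega,p_\omega)$. Then the limit of the sequence along $\omega$ with respect to weak pointed measured Gromov--Hausdorff convergence exists and is isomorphic to $({\rm spt}(\mathfrak m_\omega),d_\omega,\mathfrak m_\omega,p_\omega)$. In terms of approximations this means: there exist sequences $\tilde R_i,\tilde\varepsilon_i>0$ and weak $(\tilde R_i,\tilde\varepsilon_i)$-approximations $\psi_i$ from $X_i$ to ${\rm spt}(\mathfrak m_\omega)$ such that $\lim_{i\to\omega}\tilde R_i=+\infty$, $\lim_{i\to\omega}\tilde\varepsilon_i=0$ and $$\lim_{i\to\omega}(\psi_i)_*\mathfrak m_i=\mathfrak m_\omega$$ with respect to weak convergence in duality with $C_{bbs}({\rm spt}(\mathfrak m_\omega))$.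
   Context: For a metric space $(X,d)$, $B(x,r)$, $\bar B(x,r)$ are open/closed balls, $A^r:=\{x:{\rm dist}(x,A)<r\}$, ${\rm Ball}(X)$ is the $\sigma$-algebra generated by open balls (equal to the Borel $\sigma$-algebra if $X$ is separable). A Polish metric measure space is a complete separable metric space with a Borel measure; pointed means a point is chosen; boundedly finite means finite on balls. ${\rm spt}(\mathfrak m):=\{x:\mathfrak m(B(x,r))>0\ \forall r>0\}$. $C_{bbs}(X)$ is the set of bounded continuous functions $X\to\mathbb R$ with bounded support. Weak $(R,\varepsilon)$-approximation ($0<\varepsilon<R$) from $(X,d_X,\mathfrak m_X,p_X)$ to $(Y,d_Y,\mathfrak m_Y,p_Y)$: a Borel map $\psi\colon B(p_X,R)\to Y$ with $\psi(p_X)=p_Y$ for which there is a Borel set $\tilde X\subset B(p_X,R)$ containing $p_X$ with (1) $|d_X(x,y)-d_Y(\psi(x),\psi(y))|\le\varepsilon$ for all $x,y\in\tilde X$; (2) $\mathfrak m_X(B(p_X,R)\setminus\tilde X)\le\varepsilon$ and $\mathfrak m_Y\big(B(p_Y,R-\varepsilon)\setminus\psi(\tilde X)^\varepsilon\big)\le\varepsilon$. Such a map can always be extended in a Borel manner to the whole space $X$, and weak approximations are regarded as (so extended) Borel maps $\psi\colon X\to Y$; pushforwards $\psi_*\mathfrak m_X$ refer to these maps on $X$. In the claim, ${\rm spt}(\mathfrak m_\omega)$ carries the distance and measure restricted from $X_\omega$ and the base point $p_\omega$, and $\lim_{i\to\omega}(\psi_i)_*\mathfrak m_i=\mathfrak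 m_\omega$ means $\lim_{i\to\omega}\int\varphi\circ\psi_i\,d\mathfrak m_i=\int\varphi\,d\mathfrak m_\omega$ for every $\varphi\in C_{bbs}({\rm spt}(\mathfrak m_\omega))$. Weak pointed measured Gromov--Hausdorff (wpmGH) convergence of $(X_i,d_i,\mathfrak m_i,p_i)$ to $(X_\infty,d_\infty,\mathfrak m_\infty,p_\infty)$ as $i\to\infty$: there are $R_i\nearrow+\infty$, $\varepsilon_i\searrow0$ and weak $(R_i,\varepsilon_i)$-approximations $\psi_i$ from $X_i$ to $X_\infty$ with $(\psi_i)_*\mathfrak m_i\rightharpoonup\mathfrak m_\infty$ in duality with $C_{bbs}(X_\infty)$. Asymptotically boundedly $\mathfrak m_\omega$-totally bounded: the sequence is $\omega$-uniformly boundedly finite (for every $R>0$ there is $\eta(R)<+\infty$ with $\mathfrak m_i(B(p_i,R))\le\eta(R)$ for $\omega$-a.e. $i$), and for every $R,r,\varepsilon>0$ there are $M\in\mathbb N$ and points $(x^i_n)_{n=1}^M\subset X_i$ with $\lim_{i\to\omega}\mathfrak m_i\big(\bar B(p_i,R)\setminus\bigcup_{n=1}^MB(x^i_n,r)\big)\le\varepsilon$. Ultralimit $(X_\omega,d_\omega,\mathfrak m_\omega,p_\omega)$. ''For $\omega$-a.e. $i$'' means for all $i$ in some element of $\omega$. Let $\bar X_\omega$ be the set of families $(x_i)_{i\in S}$, $S\in\omega$, $x_i\in X_i$, modulo equality for $\omega$-a.e. $i$ (classes $[x_i]$); $\bar d_\omega([x_i],[y_i]):=\lim_{i\to\omega}d_i(x_i,y_i)$;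 $O(\bar X_\omega):=\{[x_i]:\bar d_\omega([x_i],[p_i])<+\infty\}$. $X_\omega$ is the quotient of $O(\bar X_\omega)$ by $\bar d_\omega=0$, with classes $[[x_i]]$, induced distance $d_\omega$, projection $\pi$, and $p_\omega:=[[p_i]]$. For $S\in\omega$, $A_i\in{\rm Ball}(X_i)$, $i\in S$, let $\Pi_{i\to\omega}A_i:=\{[x_i]\in\bar X_\omega:x_i\in A_i\text{ for }\omega\text{-a.e. }i\}$; $\mathcal A_O(\bar X_\omega)$ is the algebra of all sets $(\Pi_{i\to\omega}A_i)\cap O(\bar X_\omega)$, and $\bar{\mathfrak m}_\omega\big((\Pi_{i\to\omega}A_i)\cap O(\bar X_\omega)\big):=\lim_{R\to\infty}\lim_{i\to\omega}\mathfrak m_i(A_i\cap B(p_i,R))$. $N\subset O(\bar X_\omega)$ is null ($N\in\mathcal N_\omega$) if for every $\varepsilon>0$ there is $\bar A\in\mathcal A_O(\bar X_\omega)$ with $N\subset\bar A$, $\bar{\mathfrak m}_\omega(\bar A)<\varepsilon$. $\bar{\mathcal B}_\omega$ is the family of $A\subset O(\bar X_\omega)$ such that for every $R>0$ there is $\bar A_R\in\mathcal A_O(\bar X_\omega)$ with $(A\cap\Pi_{i\to\omega}B(p_i,R))\Delta\bar A_R\in\mathcal N_\omega$; for such $A$, $\bar{\mathfrak m}_\omega(A):=\lim_{R\to\infty}\bar{\mathfrak m}_\omega(\bar A_R)$. Under $\omega$-uniform bounded finiteness, $\bar{\mathcal B}_\omega$ is a $\sigma$-algebra, $\bar{\mathfrak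 m}_\omega$ a measure on it, $\pi^{-1}(A)\in\bar{\mathcal B}_\omega$ for $A\in{\rm Ball}(X_\omega)$, and $\mathfrak m_\omega(A):=\bar{\mathfrak m}_\omega(\pi^{-1}(A))$ for $A\in{\rm Ball}(X_\omega)$. ${\rm spt}(\mathfrak m_\omega)$ is closed and separable.
   Formalization: Convergence is proved for m_i restricted to B(p_i,R_i), and for all of m_i if spt(m_ω) is unbounded or no mass escapes (otherwise false); ψ_i is a weak approximation for ω-a.e. i, not every i; p_ω is added to spt(m_ω) if it is not in it. *)

(* Defs.v *)
From HB Require Import structures.
From mathcomp Require Import all_boot all_order all_algebra.
From mathcomp Require Import all_classical all_reals all_analysis.
Set Implicit Arguments.
Unset Strict Implicit.
Unset Printing Implicit Defensive.
Import Order.TTheory GRing.Theory Num.Theory.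
Import numFieldNormedType.Exports.
Local Open Scope classical_set_scope.
Local Open Scope ring_scope.
Local Open Scope quotient_scope.

(* Pointed metric spaces; the base point is [point]. *)
#[short(type="pmetricType")]
HB.structure Definition PointedMetric (K : numDomainType) :=
  {M of Metric K M & isPointed M}.

Notation borel T := (g_sigma_algebraType (@open T)).

Section metric_notions.
Context {R : realType}.
Implicit Types T : pmetricType R.

(* The completeness clause is the axiom [cauchy_cvg] of [completeType]. *)
Definition polish T :=
  (forall F : set_system T, ProperFilter F -> cauchy F -> cvg F) /\
  (exists2 D : set T, countable D & dense D).

Definition ball_salgebra T : set (set T) :=
  <<s [set B | exists x r, B = ball x r] >>.

(* [closed_ball] of the library is the closure of the open ball, which is in
   general smaller than this set. *)
Definition cball T (x : T) (r : R) : set T := [set y | mdist x y <= r].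

Definition thickening T (A : set T) (r : R) : set T :=
  [set x | (ereal_inf [set (mdist x a)%:E | a in A] < r%:E)%E].

Definition boundedly_finite T (mu : set T -> \bar R) :=
  forall r : R, (mu (ball point r) < +oo)%E.

Definition Cbbs T (phi : T -> R) :=
  [/\ continuous phi,
      exists M : R, forall x, `|phi x| <= M &
      exists r : R, [set x | phi x != 0] `<=` ball point r].

Definition unbounded_space T := forall r : R, exists x : T, r < mdist point x.

(* Weak (r, e)-approximations, regarded as Borel maps on the whole of [X]. *)
Definition weak_approx (X Y : pmetricType R) (mX : set X -> \bar R)
    (mY : set Y -> \bar R) (r e : R) (psi : X -> Y) :=
  [/\ 0 < e, e < r, measurable_fun setT (psi : borel X -> borel Y),
      psi point = point &
      exists Xt : set X,
        [/\ measurable (Xt : set (borel X)), Xt `<=` ball point r, Xt point,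
            (forall x y, Xt x -> Xt y ->
               `|mdist x y - mdist (psi x) (psi y)| <= e) &
            (mX (ball point r `\` Xt) <= e%:E)%E /\
            (mY (ball point (r - e) `\` thickening (psi @` Xt) e)
              <= e%:E)%E]].

End metric_notions.

HB.instance Definition _ (R : realType) (T : metricType R) (A : set T) :=
  PseudoMetric_isMetric.Build R (set_type A)
    (mdist := fun x y => mdist (set_val x) (set_val y))
    (fun x y => mdist_ge0 _ _)
    (fun x y h => val_inj (mdist_positivity _ _ h))
    (fun x d => congr1 (preimage set_val) (ballEmdist (set_val x) d)).

Section ultrafilter_limit.
Context {R : realType} (omega : set_system nat) {Uomega : UltraFilter omega}.
Local Open Scope ereal_scope.
Implicit Types f g : nat -> \bar R.

Definition ulim f : \bar R := lim (f i @[i --> omega]).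

Lemma ulim_cvg f : f i @[i --> omega] --> ulim f.
Proof.
suff [l fl] : exists l : \bar R, f i @[i --> omega] --> l.
  exact: (cvgP l fl).
pose L := ereal_sup [set a | \forall i \near omega, a <= f i].
have fge c : c < L -> \forall i \near omega, c <= f i.
  move=> /ereal_sup_gt[a /= af ca].
  by apply: filterS af => i; exact/le_trans/ltW.
have fle c : L < c -> \forall i \near omega, f i <= c.
  move=> Lc; have [h|h] := in_ultra_setVsetC [set i | c <= f i] Uomega.
    by exfalso; move: Lc; rewrite ltNge => /negP; apply; exact: ereal_sup_ubound.
  by apply: filterS h => i /= /negP; rewrite -ltNge => /ltW.
exists L; case: L fge fle => [l| |] fge fle.
- apply/fine_cvgP; split.
    near=> i; rewrite fin_numElt; apply/andP; split.
      by apply: (@lt_le_trans _ _ (l - 1)%:E); rewrite ?ltNyr//; near: i;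
        apply: fge; rewrite lte_fin ltrBlDr ltrDl.
    by apply: (@le_lt_trans _ _ (l + 1)%:E); rewrite ?ltry//; near: i;
      apply: fle; rewrite lte_fin ltrDl.
  apply/cvgrPdist_le => e e0; near=> i.
  have h1 : (l - e)%:E <= f i.
    by near: i; apply: fge; rewrite lte_fin ltrBlDr ltrDl.
  have h2 : f i <= (l + e)%:E by near: i; apply: fle; rewrite lte_fin ltrDl.
  rewrite /=; case: (f i) h1 h2 => [r| |]//=; rewrite !lee_fin => h1 h2.
  by rewrite distrC ler_distl h1 h2.
- by apply/cvgeyPge => A; apply: fge; rewrite ltry.
- by apply/cvgeNyPle => A; apply: fle; rewrite ltNyr.
Unshelve. all: by end_near. Qed.

Lemma eq_ulim f g : (\forall i \near omega, f i = g i) -> ulim f = ulim g.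
Proof.
move=> fg; apply/cvg_lim => //; apply: (cvg_trans _ (@ulim_cvg g)).
by apply: near_eq_cvg; apply: filterS fg => i ->.
Qed.

Lemma ulim_ge0 f : (forall i, 0 <= f i) -> 0 <= ulim f.
Proof. by move=> f0; apply: lime_ge; [exact: ulim_cvg|exact: nearW]. Qed.

Lemma ulimD f g : (forall i, 0 <= f i) -> (forall i, 0 <= g i) ->
  ulim (f \+ g) = ulim f + ulim g.
Proof.
move=> f0 g0; apply/cvg_lim => //; apply: cvgeD; [|exact: ulim_cvg..].
by apply: ge0_adde_def; rewrite inE ulim_ge0.
Qed.

Lemma le_ulim f g : (forall i, f i <= g i) -> ulim f <= ulim g.
Proof.
by move=> fg; apply: lee_lim; [exact: ulim_cvg..|exact: nearW].
Qed.

End ultrafilter_limit.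
Arguments ulim {R} omega f.

Section ultralimit.
Context {R : realType} (omega : set_system nat) (Uomega : UltraFilter omega).
Variable X : nat -> pmetricType R.

(* Since every [X i] is pointed, each family over some [S \in omega] agrees
   omega-a.e. with a family over the whole of [nat]; hence total families
   suffice, both for points here and for sets in [Pi] below. *)
Definition ae_eq_fam (x y : forall i, X i) : bool :=
  `[< \forall i \near omega, x i = y i >].

Lemma ae_eq_fam_refl : reflexive ae_eq_fam.
Proof. by move=> x; apply/asboolP; exact: nearW. Qed.

Lemma ae_eq_fam_sym : symmetric ae_eq_fam.
Proof.
by move=> x y; apply/asboolP/asboolP; apply: filterS => i.
Qed.

Lemma ae_eq_fam_trans : transitive ae_eq_fam.
Proof.
move=> y x z /asboolP xy /asboolP yz; apply/asboolP.
by apply: filterS2 xy yz => i ->.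
Qed.

Canonical ae_eq_fam_equiv :=
  EquivRel ae_eq_fam ae_eq_fam_refl ae_eq_fam_sym ae_eq_fam_trans.

Definition Xbar : Type := {eq_quot ae_eq_fam_equiv}.

HB.instance Definition _ := Choice.on Xbar.
HB.instance Definition _ := EqQuotient.on Xbar.

Definition dbar (u v : Xbar) : \bar R :=
  ulim omega (fun i => (mdist (repr u i) (repr v i))%:E).

Definition pbar : Xbar := \pi_Xbar (fun i => (point : X i)).

Definition Obar : set Xbar := [set u | (dbar u pbar < +oo)%E].

Lemma dbar_ge0 u v : (0 <= dbar u v)%E.
Proof. by apply: ulim_ge0 => i; rewrite lee_fin mdist_ge0. Qed.

Lemma dbarxx u : dbar u u = 0%E.
Proof.
rewrite /dbar (_ : (fun _ => _) = cst 0%E); first exact: lim_cst.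
by apply/funext => i; rewrite mdistxx.
Qed.

Lemma dbar_sym u v : dbar u v = dbar v u.
Proof. by congr ulim; apply/funext => i; rewrite metric_sym. Qed.

Lemma dbar_triangle v u w : (dbar u w <= dbar u v + dbar v w)%E.
Proof.
rewrite -ulimD; [|by move=> i; rewrite lee_fin mdist_ge0..].
by apply: le_ulim => i; rewrite -EFinD lee_fin metric_triangle.
Qed.

Definition d0 (u v : Obar) : bool := `[< dbar (set_val u) (set_val v) = 0%E >].

Lemma d0_refl : reflexive d0.
Proof. by move=> u; apply/asboolP; rewrite dbarxx. Qed.

Lemma d0_sym : symmetric d0.
Proof. by move=> u v; rewrite /d0 dbar_sym. Qed.

Lemma d0_trans : transitive d0.
Proof.
move=> v u w /asboolP uv /asboolP vw; apply/asboolP/eqP.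
by rewrite eq_le dbar_ge0 andbT (le_trans (dbar_triangle (set_val v) _ _))//
  uv vw adde0.
Qed.

Canonical d0_equiv := EquivRel d0 d0_refl d0_sym d0_trans.

Definition Xomega : Type := {eq_quot d0_equiv}.

HB.instance Definition _ := Choice.on Xomega.
HB.instance Definition _ := EqQuotient.on Xomega.

Definition domega (x y : Xomega) : R :=
  fine (dbar (set_val (repr x)) (set_val (repr y))).

Lemma domegaE x y :
  (domega x y)%:E = dbar (set_val (repr x)) (set_val (repr y)).
Proof.
rewrite /domega fineK// ge0_fin_numE ?dbar_ge0//.
apply: le_lt_trans (dbar_triangle pbar _ _) _.
by apply: lte_add_pinfty; [|rewrite dbar_sym];
  [exact: (set_valP (repr x))|exact: (set_valP (repr y))].
Qed.

Lemma domegaxx x : domega x x = 0.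
Proof. by rewrite /domega dbarxx. Qed.

Lemma domega_positivity x y : domega x y = 0 -> x = y.
Proof.
move=> xy0; rewrite -[x]reprK -[y]reprK; apply/eqmodP/asboolP.
by rewrite -domegaE xy0.
Qed.

Lemma domega_sym x y : domega x y = domega y x.
Proof. by rewrite /domega dbar_sym. Qed.

Lemma domega_triangle y x z : domega x z <= domega x y + domega y z.
Proof. by rewrite -lee_fin EFinD !domegaE dbar_triangle. Qed.

HB.instance Definition _ := isMetric.Build R Xomega
  domegaxx domega_positivity domega_sym domega_triangle.

Lemma pbar_Obar : pbar \in Obar.
Proof. by rewrite inE /Obar/= dbarxx. Qed.

HB.instance Definition _ :=
  isPointed.Build Xomega (\pi_Xomega (SigSub pbar_Obar : Obar)).

Definition proj_preimage (A : set Xomega) : set Xbar :=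
  set_val @` [set u : Obar | A (\pi_Xomega u)].

End ultralimit.

Section ultralimit_measure.
Context {R : realType} {omega : set_system nat} (Uomega : UltraFilter omega).
Context {X : nat -> pmetricType R}.
Variable m : forall i, {measure set (borel (X i)) -> \bar R}.

Local Notation Xbar := (Xbar Uomega X).
Local Notation Obar := (@Obar R omega Uomega X).
Local Notation Xomega := (Xomega Uomega X).

Definition Pi (A : forall i, set (X i)) : set Xbar :=
  [set u | \forall i \near omega, A i (repr u i)].

Definition presents (A : forall i, set (X i)) (B : set Xbar) :=
  (forall i, ball_salgebra (A i)) /\ B = Pi A `&` Obar.

Definition AObar : set (set Xbar) := [set B | exists A, presents A B].

Definition mbar_fam (A : forall i, set (X i)) : \bar R :=
  lim (ulim omega (fun i => m i (A i `&` ball point r)) @[r --> +oo%R]).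

(* The value is the same for all families [A] presenting [B]; [xget] selects
   one of them. *)
Definition mbarO (B : set Xbar) : \bar R :=
  mbar_fam (xget (fun i => set0) [set A | presents A B]).

Definition null_omega (N : set Xbar) := N `<=` Obar /\
  forall e : R, 0 < e ->
    exists B, [/\ AObar B, N `<=` B & (mbarO B < e%:E)%E].

Definition trunc_approx (A : set Xbar) (r : R) (B : set Xbar) :=
  AObar B /\ null_omega ((A `&` Pi (fun i => ball point r)) `+` B).

Definition Bbar : set (set Xbar) :=
  [set A | A `<=` Obar /\ forall r : R, 0 < r -> exists B, trunc_approx A r B].

(* Meaningful on [Bbar], where the value does not depend on the selected
   approximating sets. *)
Definition mbar (A : set Xbar) : \bar R :=
  lim (mbarO (xget set0 [set B | trunc_approx A r B]) @[r --> +oo%R]).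

(* Meaningful on [ball_salgebra], as are its restrictions below. *)
Definition momega (A : set Xomega) : \bar R := mbar (proj_preimage A).

Definition spt_omega : set Xomega :=
  [set x | forall r : R, 0 < r -> (0 < momega (ball x r))%E].

(* This is [spt_omega] whenever the latter contains the base point, which is
   needed for it to be a pointed space; otherwise the base point, which is then
   an isolated point of measure zero, is added. *)
Definition spt_space : Type := set_type (spt_omega `|` [set point]).

HB.instance Definition _ := Metric.on spt_space.
HB.instance Definition _ := isPointed.Build spt_space
  (SigSub (mem_set (or_intror (erefl point)))).

Definition mspt (B : set (borel spt_space)) : \bar R :=
  momega ((set_val : spt_space -> Xomega) @` B).

Definition asymp_totally_bounded :=
  (forall r : R, 0 < r ->
     exists eta : R, \forall i \near omega, (m i (ball point r) <= eta%:E)%E) /\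
  (forall r s e : R, 0 < r -> 0 < s -> 0 < e ->
     exists (M : nat) (x : forall i, 'I_M -> X i),
       (ulim omega (fun i =>
          m i (cball point r `\` \bigcup_n ball (x i n) s)) <= e%:E)%E).

(* When the limit space is bounded and mass escapes to infinity, no extension
   of the approximations outside the balls [ball point (r i)] can keep the
   escaping mass away from bounded sets. For instance, if [X i] has two points
   at distance [i.+1], each of mass 1, then [Xomega] is one point of mass 1. *)
Definition no_mass_escape :=
  forall e : R, 0 < e -> exists r : R,
    \forall i \near omega, (m i (~` ball point r) <= e%:E)%E.

End ultralimit_measure.

Arguments asymp_totally_bounded {R} omega {X} m.
Arguments no_mass_escape {R} omega {X} m.
Arguments mspt {R omega} Uomega {X} m B.

(* Main.v *)
Require Import Defs.
From HB Require Import structures.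
From mathcomp Require Import all_boot all_order all_algebra.
From mathcomp Require Import all_classical all_reals all_analysis.
From mathcomp Require Import measurable_realfun ring lra.
Set Implicit Arguments.
Unset Strict Implicit.
Unset Printing Implicit Defensive.
Import Order.TTheory GRing.Theory Num.Theory.
Import numFieldNormedType.Exports.
Local Open Scope classical_set_scope.
Local Open Scope ring_scope.

(* On the part of the ultraproduct at bounded distance from the base point, the
   measure [mbar] is a Loeb measure: by countable saturation, the sets that agree
   with an internal set up to a null set form a sigma-algebra, on which [mbar] is
   countably additive. Asymptotic total boundedness says that almost every point
   of the ultraproduct is, for infinitely many [k], in one of finitely many
   internal balls of radius [1 / k]. Hence the standard part of almost every point
   is in the support, and the support is separable.

   Given a dense sequence [w] of the support and representatives of its terms, the
   map [psi k i] sends a point of [X i] to the first [w n], [n <= N k], whose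
   representative is at distance less than [1 / k]; choosing [k] as a function of
   [i] diagonally gives the approximations. For almost every internal point [u],
   the image of [u i] converges to the standard part of [u], so superlevel sets of
   [phi \o psi i] are compared with superlevel sets of [phi] in the Loeb measure,
   and the integrals converge by the layer-cake formula. *)

(** The definition of [mbar] nests several limits and arbitrary choices. The proof therefore works
    at a fixed scale [r]: [internal r], [null r], [approximates r] and [mass r] only concern what
    happens inside [ball point r], where uniform bounded finiteness makes masses finite, and
    [mbar_mass] is the bridge back to the definitions. On [Xomega], which may fail to be separable,
    only balls are shown to be measurable at each scale; Borel sets of the support are reached
    through a countable base of balls.

    Since [mspt] is a bare set function, every argument that needs a measure replaces it on a ball
    by the measure of [spt_measure].

    The convergence statement has two forms because the mass outside [ball point (r i)] is not
    controlled. The maps send that region to a single point, which leaves every bounded set when the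
    limit space is unbounded; in the other case considered, [no_mass_escape] makes the mass
    negligible. *)

Lemma natSinv_lt {R : realType} (e : R) : 0 < e -> exists n : nat, n.+1%:R^-1 < e.
Proof.
by move=> e0; have [n] := filter_ex (near_infty_natSinv_lt (PosNum e0)); exists n.
Qed.

(** The factor 2 is there because the lemma bounds the diameter of a ball of radius [k.+1%:R^-1]. *)
Lemma natSinv_lt_near {R : realType} (e : R) : 0 < e ->
  exists n : nat, forall k, (n <= k)%N -> k.+1%:R^-1 *+ 2 < e.
Proof.
move=> e0; have [n ne] : exists n : nat, n.+1%:R^-1 < e / 2.
  by apply: natSinv_lt; rewrite divr_gt0.
exists n => k nk; suff h : k.+1%:R^-1 < e / 2 by rewrite mulr2n [e]splitr ltrD.
by apply: le_lt_trans ne; rewrite lef_pV2 ?posrE// ler_nat ltnS.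
Qed.

(** * Balls, thickenings and Borel sets in a metric space *)

Section metric_facts.
Context {R : realType} {T : pmetricType R}.
Implicit Types (x y : T) (A B : set T).

Lemma ball_mdist x (d : R) : ball x d = [set y | mdist x y < d].
Proof. exact: ballEmdist. Qed.

Lemma open_metric_ball x (d : R) : open (ball x d).
Proof.
rewrite openE => y; rewrite ball_mdist /= => xy.
apply/nbhs_ballP; exists (d - mdist x y) => /=; first by rewrite subr_gt0.
move=> z; rewrite ball_mdist /= => yz.
by rewrite (le_lt_trans (metric_triangle x y z))// -ltrBrDl.
Qed.

Lemma salgebra_measurable A : ball_salgebra A -> measurable (A : set (borel T)).
Proof.
apply: smallest_sub; first exact: sigma_algebra_measurable.
by move=> _ [x [r ->]]; apply: sub_sigma_algebra; exact: open_metric_ball.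
Qed.

Lemma salgebra_ball x (d : R) : ball_salgebra (ball x d).
Proof. by apply: sub_sigma_algebra; exists x, d. Qed.

Lemma salgebra0 : ball_salgebra (set0 : set T).
Proof. exact: sigma_algebra0. Qed.

Lemma salgebraC A : ball_salgebra A -> ball_salgebra (~` A).
Proof. by move=> mA; rewrite -setTD; exact: sigma_algebraCD. Qed.

Lemma salgebra_bigcup (F : nat -> set T) : (forall n, ball_salgebra (F n)) ->
  ball_salgebra (\bigcup_n F n).
Proof. exact: sigma_algebra_bigcup. Qed.

Lemma salgebraU A B : ball_salgebra A -> ball_salgebra B ->
  ball_salgebra (A `|` B).
Proof.
move=> mA mB; rewrite -bigcup2E; apply: salgebra_bigcup.
by case=> [|[|n]] //=; exact: salgebra0.
Qed.

Lemma salgebraI A B : ball_salgebra A -> ball_salgebra B ->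
  ball_salgebra (A `&` B).
Proof.
move=> mA mB; rewrite -[A `&` B]setCK setCI.
by apply: salgebraC; apply: salgebraU; exact: salgebraC.
Qed.

Lemma salgebraD A B : ball_salgebra A -> ball_salgebra B ->
  ball_salgebra (A `\` B).
Proof. by move=> mA mB; rewrite setDE; apply: salgebraI => //; exact: salgebraC. Qed.

Lemma salgebra_bigsetU (F : nat -> set T) N : (forall n, ball_salgebra (F n)) ->
  ball_salgebra (\big[setU/set0]_(n < N) F n).
Proof.
move=> mF; elim: N => [|N IH]; first by rewrite big_ord0; apply: salgebra0.
by rewrite big_ord_recr; apply: salgebraU; [exact: IH|exact: mF].
Qed.

Lemma salgebra_cball x (d : R) : ball_salgebra (cball x d).
Proof.
rewrite (_ : cball x d = ~` \bigcup_n ~` ball x (d + n.+1%:R^-1)).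
  apply: salgebraC; apply: salgebra_bigcup => n.
  by apply: salgebraC; exact: salgebra_ball.
apply/seteqP; split => y /=.
  move=> xy [n _]; apply; rewrite ball_mdist /=.
  by rewrite (le_lt_trans xy)// ltrDl invr_gt0.
move=> H; apply/ler_addgt0Pr => e e0.
have [n ne] := natSinv_lt e0.
have [|h] := pselect (ball x (d + n.+1%:R^-1) y).
  by rewrite ball_mdist /= => /ltW/le_trans; apply; rewrite lerD2l ltW.
by exfalso; apply: H; exists n.
Qed.

Lemma thickeningP (A : set T) (d : R) a y : A a -> mdist a y < d -> thickening A d y.
Proof.
move=> Aa ay; apply: le_lt_trans (_ : ((mdist y a)%:E < d%:E)%E).
  by apply: ereal_inf_lbound; exists a.
by rewrite lte_fin metric_sym.
Qed.

Lemma thickening_open (A : set T) (d : R) : open (thickening A d).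
Proof.
rewrite (_ : thickening A d = \bigcup_(a in A) ball a d).
  by apply: bigcup_open => a _; exact: open_metric_ball.
apply/seteqP; split => y.
  move=> /ereal_inf_lt[_ [a Aa <-]]; rewrite lte_fin => ya.
  by exists a => //; rewrite ball_mdist /= metric_sym.
move=> [a Aa]; rewrite ball_mdist /= => ay.
exact: thickeningP Aa ay.
Qed.

(** The balls of radius [k.+1%:R^-1] around the dense sequence form a countable base. Coding pairs
    by [unpickle], with empty pieces as filler, gives a union over [nat], the form under which
    measurability properties are stable. *)
Lemma open_bigcup_ball (w : nat -> T) (B : set T) :
  (forall y (e : R), 0 < e -> exists n, mdist (w n) y < e) -> open B ->
  B = \bigcup_j (if unpickle j is Some kn then
        if `[< ball (w kn.2) kn.1.+1%:R^-1 `<=` B >]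
        then ball (w kn.2) kn.1.+1%:R^-1 else set0
      else set0).
Proof.
move=> wd oB; apply/seteqP; split => y; last first.
  move=> [j _]; case: unpickle => [[k n]|//].
  by case: asboolP => // + ky; exact.
move=> By; have : nbhs y B by exact: open_nbhs_nbhs.
move=> /nbhs_ballP[e /= e0 yeB].
have [k hk] := natSinv_lt_near e0; have {}hk := hk k (leqnn k).
have [n wn] : exists n, mdist (w n) y < k.+1%:R^-1 by apply: wd; rewrite invr_gt0.
exists (pickle (k, n)) => //; rewrite pickleK /= asboolT; first by rewrite ball_mdist.
move=> z; rewrite ball_mdist /= => wz; apply: yeB; rewrite ball_mdist /=.
apply: le_lt_trans (metric_triangle _ (w n) _) _; apply: lt_trans hk.
by rewrite mulr2n metric_sym ltrD.
Qed.

Lemma continuous_borel_measurable (phi : T -> R) : continuous phi ->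
  measurable_fun setT (phi : borel T -> R).
Proof.
move=> cphi; apply: (measurability _ (RGenOpens.measurableE R)).
move=> _ [_ [a [b ->] <-]]; rewrite setTI; apply: sub_sigma_algebra.
by move/continuousP : cphi; apply; exact: interval_open.
Qed.

End metric_facts.

(** * Limits along an ultrafilter *)

Section ultrafilter.
Context {R : realType} {omega : set_system nat} (Uomega : UltraFilter omega).
Implicit Types f g : nat -> \bar R.

Lemma ultra_dec (P : nat -> Prop) :
  (\forall i \near omega, P i) \/ (\forall i \near omega, ~ P i).
Proof. exact: (in_ultra_setVsetC [set i | P i] Uomega). Qed.

Lemma ultra_contra (P : nat -> Prop) :
  ~ (\forall i \near omega, ~ P i) -> \forall i \near omega, P i.
Proof. by case: (ultra_dec P). Qed.

Lemma ultra_not_both (P : nat -> Prop) :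
  (\forall i \near omega, P i) -> (\forall i \near omega, ~ P i) -> False.
Proof.
move=> p np; have [i []] := filter_ex (filterI p np).
exact.
Qed.

Local Open Scope ereal_scope.

Lemma ulim_cst (c : \bar R) : ulim omega (fun=> c) = c.
Proof. exact: lim_cst. Qed.

Lemma le_ulim_near f g : (\forall i \near omega, f i <= g i) ->
  ulim omega f <= ulim omega g.
Proof. by move=> fg; apply: lee_lim => //; exact: ulim_cvg. Qed.

Lemma ulim_le c f : (\forall i \near omega, f i <= c) -> ulim omega f <= c.
Proof. by move=> fc; rewrite -[c]ulim_cst; exact: le_ulim_near. Qed.

Lemma ulim_ge c f : (\forall i \near omega, c <= f i) -> c <= ulim omega f.
Proof. by move=> fc; rewrite -[c]ulim_cst; exact: le_ulim_near. Qed.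

Lemma ulim_lt_near c f : ulim omega f < c -> \forall i \near omega, f i < c.
Proof.
move=> fc; apply: ultra_contra => h; move: fc; rewrite ltNge => /negP; apply.
by apply: ulim_ge; apply: filterS h => i /negP; rewrite -leNgt.
Qed.

Lemma ulim_gt_near c f : c < ulim omega f -> \forall i \near omega, c < f i.
Proof.
move=> fc; apply: ultra_contra => h; move: fc; rewrite ltNge => /negP; apply.
by apply: ulim_le; apply: filterS h => i /negP; rewrite -leNgt.
Qed.

Hypothesis non_principal : forall n, ~ omega [set n].

(** The ultrafilter decides whether [i = K], and non-principality rules out the equality, so indices
    can be discarded one at a time. *)
Lemma ultra_ge K : \forall i \near omega, (K <= i)%N.
Proof.
elim: K => [|K IH]; first exact: nearW.
have [h|h] := ultra_dec (fun i => i = K).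
  by exfalso; apply: (non_principal (n := K)).
apply: filterS2 IH h => i Ki /eqP iK.
by rewrite ltn_neqAle eq_sym iK.
Qed.

(** The witness is the largest [k <= i] for which [P k i] holds; it is at least [K] as soon as
    [K <= i] and [P K i]. *)
Lemma ultra_diagonal (P : nat -> nat -> Prop) :
  (forall k, \forall i \near omega, P k i) ->
  exists kappa : nat -> nat, (forall K, \forall i \near omega, (K <= kappa i)%N)
    /\ \forall i \near omega, P (kappa i) i.
Proof.
move=> nP; exists (fun i => \max_(k < i.+1 | `[< P k i >]) k); split.
  move=> K; apply: filterS2 (ultra_ge K) (nP K) => i Ki PKi.
  by apply: (leq_bigmax_cond (Ordinal (Ki : (K < i.+1)%N))); exact/asboolP.
(* [P 0 i] makes the set of candidates nonempty, so the maximum is attained and is not merely the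
   default value of an empty maximum. *)
have := nP 0%N; apply: filterS => i P0i.
have c0 : (0 < #|[pred k : 'I_i.+1 | `[< P k i >]]|)%N.
  by apply/card_gt0P; exists ord0; apply/asboolP.
have [k] := eq_bigmax_cond (fun k : 'I_i.+1 => k : nat) c0.
rewrite inE /= => Pk E; suff -> : \max_(j < i.+1 | `[< P j i >]) j = k.
  exact: Pk.
by rewrite -E; apply: eq_bigl => j; rewrite inE.
Qed.

End ultrafilter.

(** * Layer-cake estimates *)

Section layer_cake.
Context d (T : measurableType d) (R : realType).
Variable mu : {measure set T -> \bar R}.
Local Open Scope ereal_scope.

Import HBNNSimple.

(* [nu] need not be a measure: [mspt] is a bare set function. *)
Lemma eq_setfun_integral (nu : set T -> \bar R) (D : set T) (f : T -> \bar R) :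
  (forall A, measurable A -> A `<=` D -> nu A = mu A) ->
  (forall x, ~ D x -> f x = 0) -> \int[nu]_x f x = \int[mu]_x f x.
Proof.
move=> numu fD.
have E (g : T -> \bar R) (h : {nnsfun T >-> R}) : (forall x, ~ D x -> g x = 0) ->
    (forall x, (h x)%:E <= g x) -> sintegral nu h = sintegral mu h.
  move=> gD hg; apply: eq_fsbigr => a _.
  (* A fibre of [h] that is not inside [D] contains a point where [0 <= h <= g = 0]; its value is
     then 0 and its measure does not matter. *)
  have [haD|haD] := pselect (h @^-1` [set a] `<=` D); first by rewrite numu.
  suff -> : a = 0%R by rewrite !mul0e.
  apply: contra_notP haD => /eqP a0 x /= hx; apply: contrapT => /gD gx.
  have := hg x; rewrite gx lee_fin hx => ale0.
  by move/negP: a0; apply; rewrite eq_le ale0 -hx fun_ge0.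
have gp x : ~ D x -> (f \_ setT)^\+ x = 0.
  by move=> /fD fx; rewrite patch_setT funepos.unlock fx maxxx.
have gn x : ~ D x -> (f \_ setT)^\- x = 0.
  by move=> /fD fx; rewrite patch_setT funeneg.unlock fx oppe0 maxxx.
rewrite /integral; congr (ereal_sup _ - ereal_sup _);
  apply/seteqP; split => _ [h hg <-]; exists h => //=.
- by rewrite (E _ h gp).
- by rewrite (E _ h gp).
- by rewrite (E _ h gn).
- by rewrite (E _ h gn).
Qed.

Variables (D : set T) (f : T -> R) (h : R).
Hypotheses (mD : measurable D) (mf : measurable_fun D f) (h0 : (0 < h)%R).
Hypothesis f0 : forall x, D x -> (0 <= f x)%R.

Lemma measurable_superlevel (c : R) : measurable (D `&` [set x | (c < f x)%R]).
Proof.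
rewrite (_ : [set x | _] = f @^-1` `]c, +oo[); first exact: mf.
by apply/seteqP; split => x /=; rewrite in_itv/= andbT.
Qed.

(** The thresholds [j%:R * h] make this a majorant of [f] truncated at height [L%:R * h], and the
    thresholds [j.+1%:R * h] a minorant. *)
Let step (c : nat -> R) L (x : T) : R :=
  (\sum_(j < L) h * \1_(D `&` [set x | c j < f x]) x)%R.

Let integral_step c L : \int[mu]_(x in D) (step c L x)%:E =
  \sum_(j < L) h%:E * mu (D `&` [set x | (c j < f x)%R]).
Proof.
under eq_integral do rewrite /step -sumEFin.
rewrite ge0_integral_sum//.
- apply: eq_bigr => j _; under eq_integral do rewrite EFinM.
  rewrite ge0_integralZl//.
  + rewrite integral_indic//; last exact: measurable_superlevel.
    by rewrite setIAC setIid.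
  + apply/measurable_EFinP; apply: measurable_indic.
    exact: measurable_superlevel.
  + by rewrite lee_fin ltW.
- move=> j; apply/measurable_EFinP; apply: measurable_funM => //.
  by apply: measurable_indic; exact: measurable_superlevel.
- by move=> j x _; rewrite lee_fin mulr_ge0// ltW.
Qed.

Let stepE c L x : D x -> step c L x = (\sum_(j < L) h * (c j < f x)%R%:R)%R.
Proof.
move=> Dx; apply: eq_bigr => j _; rewrite indicE; congr (_ * _%:R)%R.
by congr nat_of_bool; apply/idP/idP; rewrite inE => //= -[].
Qed.

Let measurable_step c L : measurable_fun D (EFin \o step c L).
Proof.
apply/measurable_EFinP; apply: measurable_sum => j.
apply: measurable_funM => //.
by apply: measurable_indic; exact: measurable_superlevel.
Qed.

Let step_ge0 c L x : (0 <= step c L x)%R.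
Proof. by apply: sumr_ge0 => j _; rewrite mulr_ge0// ltW. Qed.

Lemma integral_le_layers L : (forall x, D x -> (f x <= L%:R * h)%R) ->
  \int[mu]_(x in D) (f x)%:E <=
  \sum_(j < L) h%:E * mu (D `&` [set x | (j%:R * h < f x)%R]).
Proof.
move=> fL; rewrite -(integral_step (fun j => j%:R * h)%R).
apply: ge0_le_integral => //.
- exact/measurable_EFinP.
- exact: measurable_step.
move=> x Dx; rewrite lee_fin stepE//.
(* The bound of [f x] by [L%:R * h] does not survive a decrease of [L]; the truncated inequality
   does, so it is the one proved by induction. *)
suff : (Num.min (f x) (L%:R * h) <= \sum_(j < L) h * (j%:R * h < f x)%R%:R)%R.
  by rewrite min_l ?fL.
elim: (L) => [|K IH]; first by rewrite big_ord0 mul0r ge_min lexx orbT.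
rewrite big_ord_recr /=; have [Kf|fK] := ltP (K%:R * h)%R (f x).
  have {}IH : (K%:R * h <= \sum_(j < K) h * (j%:R * h < f x)%R%:R)%R.
    by move: IH; rewrite min_r // ltW.
  rewrite mulr1.
  by rewrite ge_min -natr1 mulrDl mul1r lerD2r IH orbT.
by move: IH; rewrite mulr0 addr0 min_l// => IH; rewrite ge_min IH.
Qed.

Lemma layers_le_integral L :
  \sum_(j < L) h%:E * mu (D `&` [set x | (j.+1%:R * h < f x)%R]) <=
  \int[mu]_(x in D) (f x)%:E.
Proof.
rewrite -(integral_step (fun j => j.+1%:R * h)%R).
apply: ge0_le_integral => //.
- by move=> x Dx; rewrite lee_fin step_ge0.
- exact: measurable_step.
- exact/measurable_EFinP.
move=> x Dx; rewrite lee_fin stepE//.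
suff : (\sum_(j < L) h * (j.+1%:R * h < f x)%R%:R <= Num.min (f x) (L%:R * h))%R.
  by rewrite le_min => /andP[].
elim: (L) => [|K IH]; first by rewrite big_ord0 mul0r le_min f0/=.
rewrite big_ord_recr /=; have [Kf|fK] := ltP (K.+1%:R * h)%R (f x).
  move: IH; rewrite le_min => /andP[_ IH].
  by rewrite mulr1 -natr1 mulrDl mul1r lerD2r.
by rewrite mulr0 addr0; move: IH; rewrite le_min => /andP[].
Qed.

End layer_cake.

Lemma integral_max0 {R : realType} d (T : measurableType d) (mu : {measure set T -> \bar R})
    (D : set T) (f : T -> R) :
  (\int[mu]_(x in D) (f x)%:E = \int[mu]_(x in D) (Num.max (f x) 0)%:E -
    \int[mu]_(x in D) (Num.max (- f x) 0)%:E)%E.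
Proof.
rewrite integralE funepos.unlock funeneg.unlock; congr (_ - _)%E;
  by apply: eq_integral => x _; rewrite EFin_max.
Qed.

Section ulim_algebra.
Context {R : realType} {omega : set_system nat} (Uomega : UltraFilter omega).
Implicit Types f g : nat -> \bar R.
Local Open Scope ereal_scope.

Lemma ulimZ (c : R) f : ulim omega (fun i => c%:E * f i) = c%:E * ulim omega f.
Proof.
by apply/cvg_lim => //; apply: cvgeZl => //; exact: ulim_cvg.
Qed.

Lemma ulim_sum L (F : nat -> nat -> \bar R) : (forall j i, 0 <= F j i) ->
  ulim omega (fun i => \sum_(j < L) F j i) = \sum_(j < L) ulim omega (F j).
Proof.
move=> F0; elim: L => [|L IH].
  rewrite big_ord0 -[RHS](ulim_cst Uomega); congr ulim.
  by apply/funext => i; rewrite big_ord0.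
rewrite big_ord_recr /= -IH -ulimD//; last by move=> i; exact: sume_ge0.
by congr ulim; apply/funext => i; rewrite big_ord_recr.
Qed.

Lemma cvg_ulim f l : ulim omega f = l -> f i @[i --> omega] --> l.
Proof. by move=> <-; exact: ulim_cvg. Qed.

End ulim_algebra.

(** * Internal sets and the Loeb measure *)

Section ultralimit_support.
Context {R : realType} {omega : set_system nat} (Uomega : UltraFilter omega).
Context {X : nat -> pmetricType R}.
Implicit Types (A B C : forall i, set (X i)) (u v : Xbar Uomega X).
Local Notation Xbar := (Xbar Uomega X).
Local Notation Obar := (@Obar R omega Uomega X).
Local Notation Pi := (@Pi R omega Uomega X).

Lemma fam_ext A B : (forall i, A i = B i) -> A = B.
Proof. exact: functional_extensionality_dep. Qed.

Lemma repr_pi (x : forall i, X i) :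
  \forall i \near omega, repr (\pi_Xbar x)%qT i = x i.
Proof.
have /eqmodP/asboolP : (\pi_Xbar (repr (\pi_Xbar x)) = \pi_Xbar x)%qT.
  by rewrite reprK.
exact.
Qed.

Lemma Pi_pi A (x : forall i, X i) :
  Pi A (\pi_Xbar x)%qT <-> \forall i \near omega, A i (x i).
Proof.
split => h; apply: filterS2 h (repr_pi x) => i.
  by move=> + <-.
by move=> + ->.
Qed.

(** If the inclusion failed for almost every index, choosing points of [A i] outside [B i] would
    define a point of [Pi A] outside [Pi B]. *)
Lemma sub_PiP A B : Pi A `<=` Pi B <-> \forall i \near omega, A i `<=` B i.
Proof.
split => [AB|AB u Au]; last by apply: filterS2 AB Au => i; exact.
apply: ultra_contra => h.
pose x i : X i := xget point (A i `\` B i).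
have hx : \forall i \near omega, (A i `\` B i) (x i).
  apply: filterS h => i /existsNP[y /not_implyP[Ay By]].
  by rewrite /x; case: xgetP => [z _ []//|/(_ y)]; case.
have /AB/Pi_pi xB : Pi A (\pi_Xbar x)%qT.
  by apply/Pi_pi; apply: filterS hx => i [].
by apply: (ultra_not_both Uomega xB); apply: filterS hx => i [].
Qed.

Lemma PiI A B : Pi (fun i => A i `&` B i) = Pi A `&` Pi B.
Proof.
apply/seteqP; split => [u h|u [h1 h2]]; last exact: filterI.
by split; apply: filterS h => i [].
Qed.

Lemma PiC A : Pi (fun i => ~` A i) = ~` Pi A.
Proof.
apply/seteqP; split => [u h1 h2|u h]; first exact: (ultra_not_both Uomega h2 h1).
by case: (ultra_dec Uomega (fun i => A i (repr u i))).
Qed.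

Lemma PiD A B : Pi (fun i => A i `\` B i) = Pi A `\` Pi B.
Proof. by rewrite setDE -PiC -PiI. Qed.

Lemma PiU A B : Pi (fun i => A i `|` B i) = Pi A `|` Pi B.
Proof.
rewrite -[RHS]setCK setCU -!PiC -PiI -PiC; congr Pi.
by apply: fam_ext => i; rewrite setCI !setCK.
Qed.

Lemma sub_Pi A B : (forall i, A i `<=` B i) -> Pi A `<=` Pi B.
Proof. by move=> AB; apply/sub_PiP; exact: nearW. Qed.

Lemma Pi_bigsetU (F : nat -> forall i, set (X i)) N :
  Pi (fun i => \big[setU/set0]_(n < N) F n i) = \big[setU/set0]_(n < N) Pi (F n).
Proof.
elim: N => [|N IH].
  rewrite big_ord0; apply/seteqP; split => u // h.
  by have [i] := filter_ex h; rewrite big_ord0.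
rewrite big_ord_recr /= -IH -PiU; congr Pi.
by apply: fam_ext => i; rewrite big_ord_recr.
Qed.

Lemma Pi_ball_Obar (r : R) : Pi (fun i => ball point r) `<=` Obar.
Proof.
move=> u h; apply: (@le_lt_trans _ _ r%:E); last exact: ltry.
apply: ulim_le; apply: filterS2 h (repr_pi (fun i => point)) => i.
by rewrite ball_mdist /= => + ->; rewrite lee_fin metric_sym => /ltW.
Qed.

Variable m : forall i, {measure set (borel (X i)) -> \bar R}.
Hypothesis non_principal : forall n, ~ omega [set n].
Hypothesis m_tb : asymp_totally_bounded omega m.
Let m_bounded := m_tb.1.

(** Boundedness is built in so that [umass] is finite and agrees with [mbarO] without truncation. *)
Definition internal (r : R) A :=
  forall i, ball_salgebra (A i) /\ A i `<=` ball point r.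

Definition salg A := forall i, ball_salgebra (A i).

Definition umass A : \bar R := ulim omega (fun i => m i (A i)).

Lemma internal_salg r A : internal r A -> salg A.
Proof. by move=> h i; have [] := h i. Qed.

Lemma internal_ball r : internal r (fun i => ball point r).
Proof. by move=> i; split => //; exact: salgebra_ball. Qed.

Lemma internalI r A B : internal r A -> salg B ->
  internal r (fun i => A i `&` B i).
Proof.
move=> hA hB i; have [sA AS] := hA i; split; first exact: salgebraI.
by move=> x [/AS].
Qed.

Lemma internalD r A B : internal r A -> salg B ->
  internal r (fun i => A i `\` B i).
Proof.
move=> hA hB i; have [sA AS] := hA i; split; first exact: salgebraD.
by move=> x [/AS].
Qed.

Lemma internalU r A B : internal r A -> internal r B ->
  internal r (fun i => A i `|` B i).
Proof.
move=> hA hB i; have [sA AS] := hA i; have [sB BS] := hB i.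
by split; [exact: salgebraU|move=> x [/AS|/BS]].
Qed.

Lemma internal_le r s A : r <= s -> internal r A -> internal s A.
Proof.
move=> rs hA i; have [sA AS] := hA i; split => // x /AS.
exact: le_ball.
Qed.

Lemma internal_bigsetU r (F : nat -> forall i, set (X i)) N :
  (forall n, internal r (F n)) ->
  internal r (fun i => \big[setU/set0]_(n < N) F n i).
Proof.
move=> hF i; split.
  by apply: (@salgebra_bigsetU _ _ (F^~ i)) => n; have [] := hF n i.
elim: N => [|N IH]; first by rewrite big_ord0.
by rewrite big_ord_recr /= => x [/IH//|]; have [_] := hF N i; apply.
Qed.

Lemma internal_Pi r A : internal r A -> Pi A `<=` Pi (fun i => ball point r).
Proof. by move=> hA; apply: sub_Pi => i; have [] := hA i. Qed.

Local Open Scope ereal_scope.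

Lemma umass_ge0 A : 0 <= umass A.
Proof. exact: ulim_ge0. Qed.

Lemma le_umass A B : salg A -> salg B -> Pi A `<=` Pi B -> umass A <= umass B.
Proof.
move=> sA sB /sub_PiP AB; apply: le_ulim_near; apply: filterS AB => i ABi.
by apply: le_measure => //; rewrite inE; apply: salgebra_measurable.
Qed.

Lemma umass_fin r A : (0 < r)%R -> internal r A -> umass A \is a fin_num.
Proof.
move=> r0 hA; rewrite ge0_fin_numE ?umass_ge0//.
have [eta he] := m_bounded r0.
apply: (@le_lt_trans _ _ eta%:E); last exact: ltry.
apply: ulim_le; apply: filterS he => i; apply: le_trans.
have [sA AS] := hA i; apply: le_measure => //; rewrite inE;
  apply: salgebra_measurable => //; exact: salgebra_ball.
Qed.

Lemma umassID A B : salg A -> salg B ->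
  umass A = umass (fun i => A i `&` B i) + umass (fun i => A i `\` B i).
Proof.
move=> sA sB; rewrite /umass -ulimD//; congr ulim; apply/funext => i /=.
rewrite -measureU; first by rewrite setUIDK.
- by apply: salgebra_measurable; exact: salgebraI.
- by apply: salgebra_measurable; exact: salgebraD.
- by rewrite setDE setIACA setICr setI0.
Qed.

Lemma umassU_le A B : salg A -> salg B ->
  umass (fun i => A i `|` B i) <= umass A + umass B.
Proof.
move=> sA sB; rewrite /umass -ulimD//; apply: le_ulim => i.
by apply: measureU2; apply: salgebra_measurable.
Qed.

(* The witness is a diagonal family [U (kappa i) i] of partial unions. *)
Lemma saturation r (F : nat -> forall i, set (X i)) : (0 < r)%R ->
  (forall n, internal r (F n)) ->
  exists B, [/\ internal r B, forall n, Pi (F n) `<=` Pi B &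
    forall c, (forall N, umass (fun i => \big[setU/set0]_(n < N) F n i) <= c) ->
      umass B <= c].
Proof.
move=> r0 hF; pose U N i := \big[setU/set0]_(n < N) F n i.
have hU N : internal r (U N) by exact: internal_bigsetU.
pose a := ereal_sup (range (umass \o U)).
have Ua N : umass (U N) <= a by apply: ereal_sup_ubound; exists N.
have ale c : (forall N, umass (U N) <= c) -> a <= c.
  by move=> h; apply: ge_ereal_sup => _ [N _ <-] /=.
have afin : a \is a fin_num.
  rewrite ge0_fin_numE; last exact: le_trans (umass_ge0 _) (Ua 0%N).
  apply: (@le_lt_trans _ _ (umass (fun i => ball point r))).
    apply: ale => N; apply: le_umass; first exact: internal_salg (hU N).
      exact: internal_salg (internal_ball r).
    exact: internal_Pi (hU N).
  by rewrite -ge0_fin_numE ?umass_ge0//; apply: umass_fin r0 (internal_ball r).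
(* The [k]-th partial union is tested with precision [k.+1%:R^-1]: along the diagonal the excess
   over [a] tends to 0, while [kappa] passes every fixed [n]. *)
have nU k : \forall i \near omega, m i (U k i) < a + k.+1%:R^-1%:E.
  by apply: ulim_lt_near; apply: le_lt_trans (Ua k) _; rewrite lteDl// lte_fin invr_gt0.
have [kappa [kgt knear]] := ultra_diagonal Uomega non_principal nU.
exists (fun i => U (kappa i) i); split.
- by move=> i; exact: hU.
- move=> n; apply/sub_PiP; apply: filterS (kgt n.+1) => i ni.
  by rewrite /U -(bigcup_mkord (kappa i) (F^~ i)) => x Fx; exists n.
- move=> c /ale; apply: le_trans; apply/lee_addgt0Pr => e e0.
  have [n ne] := natSinv_lt e0.
  apply: ulim_le; apply: filterS2 (kgt n) knear => i ni /ltW/le_trans; apply.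
  rewrite leeD2l// lee_fin (le_trans _ (ltW ne))// lef_pV2 ?posrE// ler_nat ltnS//.
Qed.

(** Version of [null_omega] whose covers stay inside [ball point r]; the two notions agree on
    subsets of that internal ball. *)
Definition null r (N : set Xbar) := forall e : R, (0 < e)%R ->
  exists C, [/\ internal r C, N `<=` Pi C & umass C < e%:E].

Lemma nullS r N N' : N `<=` N' -> null r N' -> null r N.
Proof.
move=> NN h e /h[C [hC N'C mC]]; exists C; split => //.
exact: subset_trans N'C.
Qed.

Lemma null_bigcup r (N : nat -> set Xbar) : (0 < r)%R ->
  (forall n, null r (N n)) -> null r (\bigcup_n N n).
Proof.
move=> r0 nN e e0.
(* These weights sum to [e / 2], which leaves room for the strict inequality in [null]. *)
have e2 n : (0 < e / 2 ^+ n.+2)%R by rewrite divr_gt0// exprn_gt0.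
pose C n := sval (cid (nN n _ (e2 n))).
have hC n : [/\ internal r (C n), N n `<=` Pi (C n) & umass (C n) < (e / 2 ^+ n.+2)%:E].
  by rewrite /C; case: cid.
have iC n : internal r (C n) by have [] := hC n.
have [B [iB CB mB]] := saturation r0 iC.
exists B; split => //.
  by move=> u [n _ Nu]; apply: (CB n); have [_ + _] := hC n; apply.
apply: (@le_lt_trans _ _ (e / 2)%:E); last first.
  by rewrite lte_fin ltr_pdivrMr// ltr_pMr// ltr1n.
apply: mB => K.
(* This is the exact partial sum of the weights, the form in which the induction closes. *)
apply: (@le_trans _ _ (e / 2 - e / 2 ^+ K.+1)%:E); last first.
  by rewrite lee_fin lerBlDr lerDl divr_ge0// ?ltW// exprn_ge0.
elim: K => [|K IH].
  rewrite expr1 subrr.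
  by apply: ulim_le; apply: nearW => i; rewrite big_ord0 measure0.
rewrite (_ : (fun i => \big[setU/set0]_(n < K.+1) C n i) =
    (fun i => \big[setU/set0]_(n < K) C n i `|` C K i)); last first.
  by apply: fam_ext => i; rewrite big_ord_recr.
apply: le_trans (umassU_le _ _) _.
- exact: internal_salg (internal_bigsetU _ iC).
- exact: internal_salg (iC K).
have [_ _ /ltW mCK] := hC K.
apply: le_trans (leeD IH mCK) _; rewrite -EFinD lee_fin.
have -> : (e / 2 ^+ K.+1 = e / 2 ^+ K.+2 + e / 2 ^+ K.+2)%R.
  by rewrite !exprS; field; rewrite expf_neq0.
lra.
Qed.

Lemma null_set0 r : (0 < r)%R -> null r set0.
Proof.
move=> r0 e e0; exists (fun i => set0); split => //.
  by move=> i; split => //; exact: salgebra0.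
apply: (@le_lt_trans _ _ 0) => //.
by apply: ulim_le; apply: nearW => i; rewrite measure0.
Qed.

Lemma nullU r (N N' : set Xbar) : (0 < r)%R -> null r N -> null r N' ->
  null r (N `|` N').
Proof.
move=> r0 h h'; rewrite -bigcup2E; apply: null_bigcup => //.
by case=> [|[|n]] //=; exact: null_set0.
Qed.

Lemma null_umass0 r A : internal r A -> null r (Pi A) -> umass A = 0.
Proof.
move=> hA nA; apply/eqP; rewrite eq_le umass_ge0 andbT.
apply/lee_addgt0Pr => e e0; rewrite add0e.
have [C [hC AC /ltW mC]] := nA e e0.
apply: le_trans mC; apply: le_umass => //.
  exact: internal_salg hA.
exact: internal_salg hC.
Qed.

Lemma umass0_null r A : internal r A -> umass A = 0 -> null r (Pi A).
Proof. by move=> hA mA e e0; exists A; split => //; rewrite mA lte_fin. Qed.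

Lemma null_le r s N : (r <= s)%R -> null r N -> null s N.
Proof.
move=> rs nN e /nN[C [hC NC mC]]; exists C; split => //.
exact: internal_le hC.
Qed.

Lemma null_restrict r s N : null s N -> N `<=` Pi (fun i => ball point r) ->
  null r N.
Proof.
move=> nN Nr e /nN[C [hC NC mC]]; exists (fun i => ball point r `&` C i); split.
- by apply: internalI; [exact: internal_ball|exact: internal_salg hC].
- by rewrite PiI => u Nu; split; [exact: Nr|exact: NC].
- apply: le_lt_trans mC; apply: le_umass.
  + apply: (@internal_salg r); apply: internalI; first exact: internal_ball.
    exact: internal_salg hC.
  + exact: internal_salg hC.
  + by rewrite PiI => u [].
Qed.

(** * Loeb measurable sets and their mass at a fixed scale *)

Local Notation Pball r := (Pi (fun i => ball point r)).

Implicit Types (Q : set Xbar).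

(** Loeb measurability of the trace of [Q] on the internal ball of radius [r]. The set [Q] itself
    may be unbounded, so complements can be taken in the whole of [Xbar]. *)
Definition approximates r (Q : set Xbar) B :=
  internal r B /\ null r ((Q `&` Pball r) `+` Pi B).

Definition approximable r Q := exists B, approximates r Q B.

Definition mass r (Q : set Xbar) : \bar R :=
  umass (xget (fun i => set0) [set B | approximates r Q B]).

Lemma approximates_null r Q B Q' : (0 < r)%R -> approximates r Q B ->
  null r ((Q `&` Pball r) `+` (Q' `&` Pball r)) -> approximates r Q' B.
Proof.
move=> r0 [iB nAB] nAA'; split => //.
apply: nullS (nullU r0 nAB nAA') => u /=.
have [] := pselect ((Q `&` Pball r) u); rewrite /setY /=; tauto.
Qed.

(** Up to null sets [B] minus [B'] lies in [Q] minus [Q'], so it is null and [B] has the mass of its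
    intersection with [B']. Used in both directions, this makes [mass] independent of the chosen
    family. *)
Lemma le_approximates r Q Q' B B' : (0 < r)%R ->
  approximates r Q B -> approximates r Q' B' ->
  null r ((Q `&` Pball r) `\` Q') -> umass B <= umass B'.
Proof.
move=> r0 [iB nAB] [iB' nAB'] nAA'.
have sB := internal_salg iB; have sB' := internal_salg iB'.
have iBB' : internal r (fun i => B i `\` B' i) by exact: internalD.
rewrite (umassID sB sB') (null_umass0 iBB') ?adde0.
  apply: le_umass => //; last by rewrite PiI => u [].
  exact: internal_salg (internalI iB sB').
rewrite PiD; apply: nullS (nullU r0 (nullU r0 nAB nAB') nAA') => u /=.
rewrite /setY /=; have [] := pselect (Q u); have [] := pselect (Q' u).
- have := internal_Pi iB (t := u). tauto.
- have := internal_Pi iB (t := u). tauto.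
- tauto.
- tauto.
Qed.

Lemma massE r Q B : (0 < r)%R -> approximates r Q B -> mass r Q = umass B.
Proof.
move=> r0 AB; rewrite /mass; case: xgetP => [B' _ AB'|/(_ B)//].
apply/eqP; rewrite eq_le; apply/andP; split;
  [apply: (le_approximates r0 AB' AB)|apply: (le_approximates r0 AB AB')];
  by apply: nullS (null_set0 r0) => u [[]].
Qed.

Lemma mass_ge0 r Q : 0 <= mass r Q.
Proof. exact: umass_ge0. Qed.

Lemma le_mass r Q Q' : (0 < r)%R -> approximable r Q -> approximable r Q' ->
  null r ((Q `&` Pball r) `\` Q') -> mass r Q <= mass r Q'.
Proof.
move=> r0 [B AB] [B' AB'] h; rewrite (massE r0 AB) (massE r0 AB').
exact: le_approximates AB AB' h.
Qed.

Lemma approximates_internal r B : (0 < r)%R -> internal r B ->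
  approximates r (Pi B) B.
Proof.
move=> r0 iB; split => //; apply: nullS (null_set0 r0) => u.
by rewrite /setY /= => -[[[]]//|[Bu]]; apply; split => //; exact: internal_Pi iB _ Bu.
Qed.

Lemma mass_internal r B : (0 < r)%R -> internal r B -> mass r (Pi B) = umass B.
Proof. by move=> r0 iB; apply: massE => //; exact: approximates_internal. Qed.

Lemma approximates_setC r Q B : approximates r Q B ->
  approximates r (~` Q) (fun i => ball point r `\` B i).
Proof.
move=> [iB nAB]; split.
  by apply: internalD; [exact: internal_ball|exact: internal_salg iB].
rewrite PiD; apply: nullS nAB => u; rewrite /setY /=.
have := internal_Pi iB (t := u).
have [] := pselect (Q u); have [] := pselect (Pi B u); tauto.
Qed.

Lemma approximates_setU r Q Q' B B' : (0 < r)%R ->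
  approximates r Q B -> approximates r Q' B' ->
  approximates r (Q `|` Q') (fun i => B i `|` B' i).
Proof.
move=> r0 [iB nAB] [iB' nAB']; split; first exact: internalU.
rewrite PiU; apply: nullS (nullU r0 nAB nAB') => u; rewrite /setY /=.
tauto.
Qed.

Lemma approximates_set0 r : (0 < r)%R -> approximates r set0 (fun i => set0).
Proof.
move=> r0; have i0 : internal r (fun i => set0 : set (X i)).
  by move=> i; split => //; exact: salgebra0.
split => //; apply: nullS (null_set0 r0) => u; rewrite /setY /=.
move=> [[[]]//|[h _]]; have [i] := filter_ex h; exact.
Qed.

Lemma mass0 r : (0 < r)%R -> mass r set0 = 0.
Proof.
move=> r0; rewrite (massE r0 (approximates_set0 r0)).
by apply/eqP; rewrite eq_le umass_ge0 andbT; apply: ulim_le; apply: nearW => i;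
  rewrite measure0.
Qed.

(** The family [C] given by saturation has at most the supremum of the masses of the finite unions.
    Removing a large finite union thus leaves an internal set of small mass, and [Pi C] exceeds the
    union of the [Pi (B n)] by a null set only. *)
Lemma approximates_bigcup r (Q : nat -> set Xbar)
    (B : nat -> forall i, set (X i)) : (0 < r)%R ->
  (forall n, approximates r (Q n) (B n)) ->
  exists C, [/\ approximates r (\bigcup_n Q n) C, forall n, Pi (B n) `<=` Pi C &
    forall c, (forall N, umass (fun i => \big[setU/set0]_(n < N) B n i) <= c) ->
      umass C <= c].
Proof.
move=> r0 AB; have iB n : internal r (B n) by have [] := AB n.
have [C [iC BC mC]] := saturation r0 iB.
exists C; split => //; split => //.
pose U N i := \big[setU/set0]_(n < N) B n i.
have iU N : internal r (U N) by exact: internal_bigsetU.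
have iCU N : internal r (fun i => C i `\` U N i).
  by apply: internalD => //; exact: internal_salg (iU N).
have PU N : Pi (U N) = \big[setU/set0]_(n < N) Pi (B n) by rewrite Pi_bigsetU.
have nC : null r (Pi C `\` \bigcup_n Pi (B n)).
  move=> e e0.
  pose s := ereal_sup (range (umass \o U)).
  have Us N : umass (U N) <= s by apply: ereal_sup_ubound; exists N.
  have Cs : umass C <= s by apply: mC => N; exact: Us.
  have Cfin := umass_fin r0 iC.
  (* Finiteness of [umass C] is what allows [e] to be subtracted here. *)
  have [N hN] : exists N, umass C - e%:E < umass (U N).
    have : umass C - e%:E < s.
      by apply: lt_le_trans Cs; rewrite lteBlDr// lteDl// lte_fin.
    by move=> /ereal_sup_gt[_ [N _ <-]] h; exists N.
  exists (fun i => C i `\` U N i); split => //.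
    rewrite PiD PU -(bigcup_mkord N (fun n => Pi (B n))); apply: setDS => u [k /= _ Bu]; exists k => //.
  have UC : Pi (U N) `<=` Pi C.
    by rewrite PU -(bigcup_mkord N (fun n => Pi (B n))) => u [k _ /BC].
  have := umassID (internal_salg iC) (internal_salg (iU N)).
  rewrite (_ : umass (fun i => C i `&` U N i) = umass (U N)); last first.
    apply/eqP; rewrite eq_le; apply/andP; split; apply: le_umass => //;
      try exact: internal_salg (iU N);
      try exact: internal_salg (internalI iC (internal_salg (iU N)));
      rewrite PiI => u; [by case|by move=> Uu; split => //; exact: UC].
  move=> E; move: hN; rewrite E.
  have := umass_fin r0 (iU N); have := umass_fin r0 (iCU N).
  case: (umass (U N)) => [b| |]//; case: (umass _) => [a| |]// _ _.
  by rewrite -!EFinD !lte_fin; lra.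
have nAB : null r (\bigcup_n ((Q n `&` Pball r) `+` Pi (B n))).
  by apply: null_bigcup => // n; have [] := AB n.
apply: nullS (nullU r0 nAB nC) => u; rewrite /setY /=.
case=> [[[[n _ Anu] ru] nCu]|[Cu nAu]].
  by left; exists n => //; left; split => // /BC.
have [[n _ Bnu]|h] := pselect ((\bigcup_n Pi (B n)) u); last by right.
left; exists n => //; right; split => // -[Anu ru].
by apply: nAu; split => //; exists n.
Qed.

Lemma approximable_setC r Q : approximable r Q -> approximable r (~` Q).
Proof. by move=> [B /approximates_setC AB]; eexists; exact: AB. Qed.

Lemma approximable_set0 r : (0 < r)%R -> approximable r set0.
Proof. by move=> /approximates_set0; eexists; eassumption. Qed.

Lemma approximable_bigcup r (Q : nat -> set Xbar) : (0 < r)%R ->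
  (forall n, approximable r (Q n)) -> approximable r (\bigcup_n Q n).
Proof.
move=> r0 AB; have [B hB] := choice AB.
by have [C [AC _ _]] := approximates_bigcup r0 hB; exists C.
Qed.

Lemma approximable_setU r Q Q' : (0 < r)%R -> approximable r Q ->
  approximable r Q' -> approximable r (Q `|` Q').
Proof.
by move=> r0 [B AB] [B' AB']; eexists; exact: approximates_setU AB AB'.
Qed.

Lemma approximable_setI r Q Q' : (0 < r)%R -> approximable r Q ->
  approximable r Q' -> approximable r (Q `&` Q').
Proof.
move=> r0 AB AB'; rewrite -[_ `&` _]setCK setCI; apply: approximable_setC.
by apply: approximable_setU => //; exact: approximable_setC.
Qed.

Lemma approximable_setD r Q Q' : (0 < r)%R -> approximable r Q ->
  approximable r Q' -> approximable r (Q `\` Q').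
Proof.
by move=> r0 AB AB'; rewrite setDE; apply: approximable_setI => //;
  exact: approximable_setC.
Qed.

Lemma approximable_Pi r B : (0 < r)%R -> salg B -> approximable r (Pi B).
Proof.
move=> r0 sB; exists (fun i => ball point r `&` B i); split.
  by apply: internalI => //; exact: internal_ball.
by rewrite PiI setIC setYK; exact: null_set0.
Qed.

Lemma approximable_null r Q : (0 < r)%R -> null r (Q `&` Pball r) ->
  approximable r Q.
Proof.
move=> r0 nA; exists (fun i => set0); apply: (approximates_null r0 (approximates_set0 r0)).
by apply: nullS nA => u; rewrite /setY /=; tauto.
Qed.

Lemma mass_eq0 r Q : (0 < r)%R -> approximable r Q -> mass r Q = 0 ->
  null r (Q `&` Pball r).
Proof.
move=> r0 [B AB]; rewrite (massE r0 AB) => mB.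
have [iB nAB] := AB; apply: nullS (nullU r0 nAB (umass0_null iB mB)) => u.
rewrite /setY /=; have [] := pselect (Pi B u); tauto.
Qed.

Lemma mass_fin r Q : (0 < r)%R -> approximable r Q -> mass r Q \is a fin_num.
Proof.
by move=> r0 [B AB]; rewrite (massE r0 AB); apply: (umass_fin r0); case: AB.
Qed.

Lemma massU r Q Q' : (0 < r)%R -> approximable r Q -> approximable r Q' ->
  Q `&` Q' = set0 -> mass r (Q `|` Q') = mass r Q + mass r Q'.
Proof.
move=> r0 [B AB] [B' AB'] AA'.
rewrite (massE r0 AB) (massE r0 AB') (massE r0 (approximates_setU r0 AB AB')).
have [[iB nAB] [iB' nAB']] := (AB, AB').
have sB := internal_salg iB; have sB' := internal_salg iB'.
rewrite (umassID (internal_salg (internalU iB iB')) sB) (umassID sB' sB).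
rewrite (_ : (fun i => (B i `|` B' i) `&` B i) = B); last first.
  by apply: fam_ext => i; rewrite setUK.
rewrite (null_umass0 (internalI iB' sB)) ?add0e.
  by congr (_ + umass _); apply: fam_ext => i; rewrite setDUl setDv set0U.
rewrite PiI; apply: nullS (nullU r0 nAB nAB') => u; rewrite /setY /=.
have : ~ (Q u /\ Q' u) by move=> AAu; have : (Q `&` Q') u by []; rewrite AA'.
have [] := pselect (Q u); tauto.
Qed.

Lemma approximable_bigsetU r (Q : nat -> set Xbar) N : (0 < r)%R ->
  (forall n, approximable r (Q n)) ->
  approximable r (\big[setU/set0]_(n < N) Q n).
Proof.
move=> r0 hA; elim: N => [|N IH]; first by rewrite big_ord0; exact: approximable_set0.
by rewrite big_ord_recr; exact: approximable_setU.
Qed.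

(** The series converges to the supremum of its partial sums. The saturated family bounds the mass
    of the union by this supremum, and monotonicity gives the other inequality. *)
Lemma mass_semi_sigma_additive r (Q : nat -> set Xbar) : (0 < r)%R ->
  (forall n, approximable r (Q n)) -> trivIset setT Q ->
  (\sum_(0 <= k < n) mass r (Q k)) @[n --> \oo] --> mass r (\bigcup_n Q n).
Proof.
move=> r0 hA tA.
have mU n : \sum_(0 <= k < n) mass r (Q k) = mass r (\big[setU/set0]_(k < n) Q k).
  elim: n => [|n IH]; first by rewrite big_geq// big_ord0 mass0.
  rewrite big_nat_recr//= IH big_ord_recr /= massU//.
    exact: approximable_bigsetU.
  rewrite -bigcup_mkord; apply/seteqP; split => // u [[k /= kn Au] Anu].
  have := tA k n Logic.I Logic.I; move=> /(_ (ex_intro _ u (conj Au Anu))) kE.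
  by move: kn; rewrite kE ltnn.
rewrite (_ : mass r _ = ereal_sup (range (fun n => \sum_(0 <= k < n) mass r (Q k)))).
  apply: ereal_nondecreasing_cvgn; apply: ereal_nondecreasing_series => n _ _.
  exact: mass_ge0.
have [B hB] := choice hA.
have [C [AC BC mC]] := approximates_bigcup r0 hB.
apply/eqP; rewrite eq_le; apply/andP; split.
  rewrite (massE r0 AC); apply: mC => N; apply: ereal_sup_ubound; exists N => //.
  rewrite mU; apply: massE => //; elim: N => [|N IH].
    rewrite big_ord0 (_ : (fun i => _) = fun i => set0).
      exact: approximates_set0.
    by apply: fam_ext => i; rewrite big_ord0.
  rewrite big_ord_recr (_ : (fun i => \big[setU/set0]_(n < N.+1) B n i) =
    (fun i => \big[setU/set0]_(n < N) B n i `|` B N i)).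
    exact: approximates_setU.
  by apply: fam_ext => i; rewrite big_ord_recr.
apply: ge_ereal_sup => _ [N _ <-]; rewrite mU; apply: le_mass => //.
- exact: approximable_bigsetU.
- exact: approximable_bigcup.
- rewrite -bigcup_mkord; apply: nullS (null_set0 r0).
  by move=> u [[[k _ Au] _]]; case; exists k.
Qed.

(** * Comparison of the mass at a fixed scale with [mbar] *)

Lemma approximates_le r s Q B : (0 < r)%R -> (r <= s)%R -> Q `<=` Pball r ->
  approximates r Q B -> approximates s Q B.
Proof.
move=> r0 rs Ar [iB nAB]; split; first exact: internal_le iB.
apply: nullS (null_le rs nAB) => u; rewrite /setY /=.
have := Ar u; have := sub_Pi (fun i => le_ball rs : ball (point : X i) r `<=` _) (t := u).
tauto.
Qed.

Lemma mass_le r s Q : (0 < r)%R -> (r <= s)%R -> Q `<=` Pball r ->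
  approximable r Q -> mass s Q = mass r Q.
Proof.
move=> r0 rs Ar [B AB]; rewrite (massE r0 AB); apply: massE.
  exact: lt_le_trans rs.
exact: approximates_le AB.
Qed.

Lemma mbar_fam_ge B (s : R) : salg B ->
  umass (fun i => B i `&` ball point s) <= @mbar_fam R omega X m B.
Proof.
move=> sB; pose f (s : R) := umass (fun i => B i `&` ball point s).
have fnd : nondecreasing_fun f.
  move=> a b ab; apply: le_umass.
  - by move=> i; apply: salgebraI => //; exact: salgebra_ball.
  - by move=> i; apply: salgebraI => //; exact: salgebra_ball.
  - by apply: sub_Pi => i x [Bx ax]; split => //; exact: le_ball ab _ ax.
rewrite /mbar_fam (cvg_lim _ (nondecreasing_cvge fnd))//.
by apply: ereal_sup_ubound; exists s.
Qed.

(** The family inside [mbarO] is an unspecified choice, so the value is tested on every presenting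
    family. *)
Lemma mbarO_lim (Q : set Xbar) (c : \bar R) (r : R) : AObar Q ->
  (forall B s, presents B Q -> (r <= s)%R ->
    umass (fun i => B i `&` ball point s) = c) -> mbarO m Q = c.
Proof.
move=> [B BQ] h; rewrite /mbarO; case: xgetP => [B' _ BQ'|/(_ B)//].
apply: lim_near_cst => //; near=> s; apply: h BQ' _.
by near: s; apply: nbhs_pinfty_ge; rewrite num_real.
Unshelve. all: by end_near. Qed.

Lemma Pi_internal_Obar r B : internal r B -> Pi B `<=` Obar.
Proof. by move=> /internal_Pi BP; apply: subset_trans BP _; exact: Pi_ball_Obar. Qed.

Lemma AObar_Pi r B : internal r B -> AObar (Pi B).
Proof.
move=> iB; exists B; split; first exact: internal_salg iB.
by rewrite setIidl//; exact: Pi_internal_Obar iB.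
Qed.

Lemma presents_ball B Q (s : R) : presents B Q ->
  Pi (fun i => B i `&` ball point s) = Q `&` Pball s.
Proof.
move=> [sB ->]; rewrite PiI -setIA; congr (_ `&` _).
by rewrite setIidr//; exact: Pi_ball_Obar.
Qed.

Lemma presents_internal B Q (s : R) : presents B Q ->
  internal s (fun i => B i `&` ball point s).
Proof.
move=> [sB _] i; split; last by move=> x [].
by apply: salgebraI => //; exact: salgebra_ball.
Qed.

Lemma umass_eq B B' : salg B -> salg B' -> Pi B = Pi B' -> umass B = umass B'.
Proof.
by move=> sB sB' E; apply/eqP; rewrite eq_le !le_umass// E.
Qed.

Lemma mbarO_internal r B : internal r B -> mbarO m (Pi B) = umass B.
Proof.
move=> iB; apply: (mbarO_lim (r := r)); first exact: AObar_Pi iB.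
move=> B' s PB' rs; apply: umass_eq.
- exact: internal_salg (presents_internal s PB').
- exact: internal_salg iB.
- rewrite (presents_ball s PB') setIidl//.
  exact: subset_trans (internal_Pi iB) (sub_Pi (fun i => le_ball rs)).
Qed.

(** A cover taken from [AObar] may be unbounded; cutting it by the ball does not increase its mass,
    because [mbar_fam] is a supremum over radii. *)
Lemma null_omega_null r N : null_omega m N -> N `<=` Pball r -> null r N.
Proof.
move=> [_ nN] Nr e /nN[Q [[B BQ] NQ]]; rewrite /mbarO.
case: xgetP => [B' _ BQ' h|/(_ B)//].
exists (fun i => B' i `&` ball point r); split.
- exact: presents_internal BQ'.
- by rewrite (presents_ball r BQ') => u Nu; split; [exact: NQ|exact: Nr].
- by apply: le_lt_trans h; apply: mbar_fam_ge; case: BQ'.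
Qed.

Lemma null_null_omega r N : null r N -> null_omega m N.
Proof.
move=> nN; split.
  have [C [iC NC _]] := nN 1%R ltr01.
  exact: subset_trans NC (Pi_internal_Obar iC).
move=> e /nN[C [iC NC mC]]; exists (Pi C); split => //.
  exact: AObar_Pi iC.
by rewrite (mbarO_internal iC).
Qed.

(** Once [s >= r], truncating [Q] at [s] gives back [Q], so the limits over radii in [mbar] are
    eventually constant. *)
Lemma mbar_mass r (Q : set Xbar) : (0 < r)%R -> Q `<=` Pball r ->
  approximable r Q -> mbar m Q = mass r Q.
Proof.
move=> r0 Qr [B QB]; rewrite (massE r0 QB).
have QI s : (r <= s)%R -> Q `&` Pball s = Q.
  move=> rs; rewrite setIidl//.
  exact: subset_trans Qr (sub_Pi (fun i => le_ball rs)).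
have tB s : (r <= s)%R -> trunc_approx m Q s (Pi B).
  move=> rs; have [iB nQB] := QB; split; first exact: AObar_Pi iB.
  by rewrite QI//; move: nQB; rewrite QI//; exact: null_null_omega.
apply: lim_near_cst => //; near=> s.
have rs : (r <= s)%R by near: s; apply: nbhs_pinfty_ge; rewrite num_real.
case: xgetP => [Q' _ [Q'A nQ']|/(_ _ (tB s rs))//].
(* The selected [Q'] may reach beyond [Pball s]. Its cuts at all [t >= s] still approximate [Q],
   which fixes the inner limit. *)
apply: (mbarO_lim (r := s)) => // B' t PB' st.
have rt : (r <= t)%R by exact: le_trans rs st.
have t0 : (0 < t)%R by exact: lt_le_trans rt.
have QB' : approximates t Q (fun i => B' i `&` ball point t).
  split; first exact: presents_internal PB'.
  rewrite (presents_ball t PB') QI//; apply: null_omega_null; last first.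
    have := Qr; have := sub_Pi (fun i => le_ball rt : ball (point : X i) r `<=` _).
    by move=> h h' u; rewrite /setY /=; have := h' u; have := h u; tauto.
  move: nQ'; rewrite QI// => -[h1 h2]; split.
    move=> u; rewrite /setY /=; have := h1 u; rewrite /setY /=.
    have := Qr u; have := sub_Pi (fun i => le_ball rt : ball (point : X i) r `<=` _) (t := u).
    tauto.
  move=> e /h2[D [AD QD mD]]; exists D; split => //; apply: subset_trans QD.
  move=> u; rewrite /setY /=.
  have := Qr u; have := sub_Pi (fun i => le_ball rt : ball (point : X i) r `<=` _) (t := u).
  tauto.
rewrite -(massE t0 QB') -(massE r0 QB); apply: mass_le => //.
by exists B.
Unshelve. all: by end_near. Qed.

(** * Standard parts and the support *)

Local Notation Xomega := (Xomega Uomega X).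

Definition rep (x : Xomega) : Xbar := set_val (repr x).

(* [x] is the standard part of [u]. *)
Definition std u (x : Xomega) := Obar u /\ dbar u (rep x) = 0.

Lemma dbar0_eq u u' v : dbar u u' = 0 -> dbar u v = dbar u' v.
Proof.
move=> uu'; apply/eqP; rewrite eq_le; apply/andP; split.
  by apply: le_trans (dbar_triangle u' u v) _; rewrite uu' add0e.
by apply: le_trans (dbar_triangle u u' v) _; rewrite dbar_sym uu' add0e.
Qed.

Lemma std_rep x : std (rep x) x.
Proof. by split; [exact: (set_valP (repr x))|rewrite dbarxx]. Qed.

Lemma std_dist u v (x y : Xomega) : std u x -> std v y -> (mdist x y)%:E = dbar u v.
Proof.
move=> [_ ux] [_ vy].
rewrite (dbar0_eq v ux) [RHS]dbar_sym (dbar0_eq _ vy) dbar_sym.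
exact: domegaE.
Qed.

Lemma std_pi u (ou : u \in Obar) : std u (\pi_Xomega (SigSub ou : Obar))%qT.
Proof.
split; first by move: (ou); rewrite inE.
have /eqmodP/asboolP : (\pi_Xomega (repr (\pi_Xomega (SigSub ou : Obar))) =
  \pi_Xomega (SigSub ou : Obar))%qT by rewrite reprK.
by rewrite dbar_sym.
Qed.

Lemma std_exists u : Obar u -> exists x, std u x.
Proof. by move=> ou; exists (\pi_Xomega (SigSub (mem_set ou) : Obar))%qT; exact: std_pi. Qed.

Lemma std_uniq u x y : std u x -> std u y -> x = y.
Proof.
move=> ux uy; apply: mdist_positivity; apply: EFin_inj.
by rewrite (std_dist ux uy) dbarxx.
Qed.

Lemma std_point : std (pbar Uomega X) (point : Xomega).
Proof. exact: std_pi. Qed.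

Lemma proj_preimageE (Q : set Xomega) :
  proj_preimage Q = [set u | exists2 x, Q x & std u x].
Proof.
apply/seteqP; split => [_ [[u ou] /= Qu <-]|u [x Qx ux]].
  by eexists; [exact: Qu|exact: std_pi].
have ou : u \in Obar by rewrite inE; case: ux.
exists (SigSub ou) => //=.
by rewrite (std_uniq (std_pi ou) ux).
Qed.

Lemma std_dist_lt u v x y (c : R) : std u x -> std v y -> (mdist x y < c)%R ->
  \forall i \near omega, (mdist (repr u i) (repr v i) < c)%R.
Proof.
move=> ux vy; rewrite -lte_fin (std_dist ux vy) => /ulim_lt_near.
by apply: filterS => i; rewrite lte_fin.
Qed.

Lemma std_dist_gt u v x y (c : R) : std u x -> std v y -> (c < mdist x y)%R ->
  \forall i \near omega, (c < mdist (repr u i) (repr v i))%R.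
Proof.
move=> ux vy; rewrite -lte_fin (std_dist ux vy) => /ulim_gt_near.
by apply: filterS => i; rewrite lte_fin.
Qed.

Lemma std_dist_le u v x y (c : R) : std u x -> std v y ->
  (\forall i \near omega, (mdist (repr u i) (repr v i) <= c)%R) ->
  (mdist x y <= c)%R.
Proof.
move=> ux vy h; rewrite leNgt; apply/negP => /(std_dist_gt ux vy) g.
by apply: (ultra_not_both Uomega h); apply: filterS g => i; rewrite ltNge => /negP.
Qed.

Lemma std_Pball u x (r : R) : std u x -> (mdist point x < r)%R -> Pball r u.
Proof.
move=> ux /(std_dist_lt std_point ux) h.
apply: filterS2 h (repr_pi (fun i => point)) => i + E.
by rewrite ball_mdist /= -E.
Qed.

(** Strict inequalities between representatives only give weak ones between standard parts. Later
    arguments therefore use a scale larger than the ball under study. *)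
Lemma Pball_std u x (r : R) : std u x -> Pball r u -> (mdist point x <= r)%R.
Proof.
move=> ux h; apply: (std_dist_le std_point ux).
apply: filterS2 h (repr_pi (fun i => point)) => i.
by rewrite ball_mdist /= => + ->; exact: ltW.
Qed.

Lemma Pi_ball_near (x : Xomega) v (a : R) :
  Pi (fun i => ball (repr (rep x) i) a) v -> Obar v.
Proof.
move=> h; have [ox _] := std_rep x; rewrite /Obar /=.
apply: le_lt_trans (dbar_triangle (rep x) _ _) _; apply: lte_add_pinfty => //.
apply: (@le_lt_trans _ _ a%:E); last exact: ltry.
apply: ulim_le; apply: filterS h => i; rewrite ball_mdist /= lee_fin metric_sym.
exact: ltW.
Qed.

(** The gap [n.+1%:R^-1] absorbs the loss of strictness in passing to standard parts. Balls of
    [Xomega] thus come from countable unions of internal sets. *)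
Lemma proj_preimage_ball (x : Xomega) (s : R) : proj_preimage (ball x s) =
  \bigcup_n Pi (fun i => ball (repr (rep x) i) (s - n.+1%:R^-1)).
Proof.
rewrite proj_preimageE; apply/seteqP; split => u.
  move=> [y]; rewrite ball_mdist /= => xy uy.
  have [n ns] : exists n : nat, (n.+1%:R^-1 < s - mdist x y)%R.
    by apply: natSinv_lt; rewrite subr_gt0.
  exists n => //; have : (mdist x y < s - n.+1%:R^-1)%R.
    by rewrite ltrBrDl -ltrBrDr.
  move=> /(std_dist_lt (std_rep x) uy); apply: filterS => i.
  by rewrite ball_mdist.
move=> [n _ h]; have [y uy] := std_exists (Pi_ball_near h).
exists y => //; rewrite ball_mdist /=.
have : (mdist x y <= s - n.+1%:R^-1)%R.
  apply: (std_dist_le (std_rep x) uy); apply: filterS h => i.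
  by rewrite ball_mdist /= => /ltW.
by move=> /le_lt_trans; apply; rewrite ltrBlDr ltrDl invr_gt0.
Qed.

Lemma approximable_ball r (x : Xomega) (s : R) : (0 < r)%R ->
  approximable r (proj_preimage (ball x s)).
Proof.
move=> r0; rewrite proj_preimage_ball; apply: approximable_bigcup => // n.
by apply: approximable_Pi => // i; exact: salgebra_ball.
Qed.

Lemma proj_preimage_sub (Q : set Xomega) (r : R) :
  Q `<=` ball point r -> proj_preimage Q `<=` Pball r.
Proof.
move=> Qr u; rewrite proj_preimageE => -[x /Qr + ux].
by rewrite ball_mdist /=; exact: std_Pball.
Qed.

Lemma sub_ball_point (x : Xomega) (s : R) :
  ball x s `<=` ball point (mdist point x + s).
Proof.
move=> y; rewrite !ball_mdist /= => xy.
by rewrite (le_lt_trans (metric_triangle point x y))// ltrD2l.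
Qed.

Lemma momega_ball (x : Xomega) (s r : R) : (0 < r)%R ->
  (mdist point x + s <= r)%R ->
  momega m (ball x s) = mass r (proj_preimage (ball x s)).
Proof.
move=> r0 xsr; apply: mbar_mass => //; last exact: approximable_ball.
apply: subset_trans (proj_preimage_sub (@sub_ball_point x s)) _.
by apply: sub_Pi => i; exact: le_ball.
Qed.

(** * Nets, the complement of the support, and separability *)

Local Open Scope ring_scope.

(** Radius, mesh and error are all tied to one index, so countably many nets serve every scale and
    precision. *)
Lemma asymptotic_nets : exists (M : nat -> nat) (c : nat -> nat -> forall i, X i),
  forall k, (umass (fun i => cball point k.+1%:R `\`
    \big[setU/set0]_(n < M k) ball (c k n i) k.+1%:R^-1) <= (k.+1%:R^-1)%:E)%E.
Proof.
suff H k : exists Mc : nat * (nat -> forall i, X i),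
    (umass (fun i => cball point k.+1%:R `\`
    \big[setU/set0]_(n < Mc.1) ball (Mc.2 n i) k.+1%:R^-1) <= (k.+1%:R^-1)%:E)%E.
  have [Mc hMc] := choice H.
  by exists (fun k => (Mc k).1), (fun k => (Mc k).2).
have k0 : 0 < k.+1%:R :> R by [].
have k1 : 0 < k.+1%:R^-1 :> R by rewrite invr_gt0.
have [M [x hx]] := m_tb.2 _ _ _ k0 k1 k1.
(* The net is extended from ordinals to [nat] by the base point; the union stops at [M], so the
   added values do not enter it. *)
exists (M, fun n i => if insub n is Some j then x i j else point) => /=.
apply: le_trans hx; rewrite /umass le_eqVlt; apply/orP; left; apply/eqP.
congr ulim; apply/funext => i; congr (m i (_ `\` _)).
rewrite -(bigcup_mkord M (fun n => ball (if insub n is Some j then x i j else point) _)).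
apply/seteqP; split => y [n].
  by move=> /= nM; rewrite (insubT (fun n => n < M)%N nM); exists (Sub n nM).
by move=> _ ny; exists n => /=; rewrite ?valK.
Qed.

Definition cell (c : nat -> nat -> forall i, X i) k n : set Xbar :=
  Pi (fun i => ball (c k n i) k.+1%:R^-1).

(** The complement of the upper limit of the cells: the points that lie in cells of finitely many
    scales only. *)
Definition evades c : set Xbar :=
  [set u | exists K, forall k n, (K <= k)%N -> ~ cell c k n u].

Lemma evades_null : exists c, forall r, 0 < r -> null r (Pball r `&` evades c).
Proof.
have [M [c hc]] := asymptotic_nets; exists c => r r0.
suff nK K : null r (Pball r `&` [set u | forall k n, (K <= k)%N -> ~ cell c k n u]).
  by apply: nullS (null_bigcup r0 nK) => u [ru [K hK]]; exists K.
move=> e e0; have [n0 ne] := natSinv_lt e0.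
(* This scale is past [K], its net concerns a ball containing that of radius [r], and its error is
   below [e]. *)
pose k := maxn K (maxn n0 (Num.truncn r)).
have kr : r <= k.+1%:R.
  apply/ltW/(lt_le_trans (truncnS_gt r)); rewrite ler_nat ltnS.
  by rewrite /k !leq_max leqnn !orbT.
have ke : k.+1%:R^-1 < e.
  apply: le_lt_trans ne; rewrite lef_pV2 ?posrE// ler_nat ltnS.
  by rewrite /k !leq_max leqnn !orbT.
pose G i := cball (point : X i) k.+1%:R `\`
  \big[setU/set0]_(n < M k) ball (c k n i) k.+1%:R^-1.
have sG : salg G.
  move=> i; apply: salgebraD; first exact: salgebra_cball.
  by apply: (salgebra_bigsetU (F := fun n => ball (c k n i) _)) => n;
    exact: salgebra_ball.
exists (fun i => ball point r `&` G i); split.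
- by apply: internalI => //; exact: internal_ball.
- rewrite PiI PiD => u [ru hu]; split => //; split.
    apply: filterS ru => i; rewrite ball_mdist /cball /= => /ltW/le_trans; exact.
  rewrite (Pi_bigsetU (fun n i => ball (c k n i) k.+1%:R^-1)).
  rewrite -(bigcup_mkord (M k) (fun n => Pi (fun i => ball (c k n i) k.+1%:R^-1))).
  by move=> [n _]; apply: hu; rewrite /k leq_maxl.
- apply: (@le_lt_trans _ _ (umass G)).
    apply: le_umass => //; last by rewrite PiI => u [].
    by move=> i; apply: salgebraI => //; exact: salgebra_ball.
  by apply: le_lt_trans (hc k) _; rewrite lte_fin.
Qed.

Definition spt_set : set Xomega := spt_omega m `|` [set point].

Lemma cell_diam c k n u v : cell c k n u -> cell c k n v -> Obar u ->
  Obar v /\ forall x y, std u x -> std v y -> mdist x y <= k.+1%:R^-1 *+ 2.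
Proof.
move=> cu cv ou.
have uv : \forall i \near omega, mdist (repr u i) (repr v i) <= k.+1%:R^-1 *+ 2.
  apply: filterS2 cu cv => i; rewrite !ball_mdist /= => a b.
  apply: le_trans (metric_triangle _ (c k n i) _) _.
  by rewrite mulr2n metric_sym; apply: ltW; exact: ltrD.
split; last by move=> x y ux vy; exact: (std_dist_le ux vy).
apply: le_lt_trans (dbar_triangle u _ _) _; apply: lte_add_pinfty => //.
rewrite dbar_sym; apply: (@le_lt_trans _ _ (k.+1%:R^-1 *+ 2)%:E); last exact: ltry.
by apply: ulim_le; apply: filterS uv => i; rewrite lee_fin.
Qed.

Lemma momega_ball_ge0 (x : Xomega) (s : R) : (0 <= momega m (ball x s))%E.
Proof.
have r0 : 0 < Num.max 1 (mdist point x + s) by rewrite lt_max ltr01.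
by rewrite (momega_ball (x := x) (s := s) r0) ?mass_ge0// le_max lexx orbT.
Qed.

(* Outside the support, a cell around a point that does not evade the nets lies
   in a null ball, and there are only countably many cells. *)
Lemma cospt_null r : 0 < r -> null r (Pball r `&` proj_preimage (~` spt_set)).
Proof.
move=> r0; have [c nc] := evades_null.
pose N kn := if `[< null r (cell c kn.1 kn.2 `&` Pball r) >]
  then cell c kn.1 kn.2 `&` Pball r else set0.
have nN : null r (\bigcup_j (if unpickle j is Some kn then N kn else set0)).
  apply: null_bigcup => // j; case: unpickle => [kn|]; last exact: null_set0.
  by rewrite /N; case: asboolP => // _; exact: null_set0.
apply: nullS (nullU r0 (nc r r0) nN) => u [ru].
rewrite proj_preimageE => -[x xS ux].
have [eu|neu] := pselect (evades c u); [by left|right].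
have [s s0 xs0] : exists2 s : R, 0 < s & momega m (ball x s) = 0%E.
  apply: contrapT => h; apply: xS; left => s s0.
  rewrite lt_neqAle momega_ball_ge0 andbT eq_sym; apply/negP => /eqP xs.
  by apply: h; exists s.
have [K hK] := natSinv_lt_near s0.
have [k [n [Kk cu]]] : exists k n, (K <= k)%N /\ cell c k n u.
  apply: contrapT => h; apply: neu; exists K => k n Kk cu; apply: h.
  by exists k, n.
exists (pickle (k, n)) => //; rewrite pickleK /N /= asboolT//.
(* The null ball around [x] may leave the ball of radius [r]; nullity is obtained at the larger
   scale [t] and then restricted. *)
pose t := Num.max r (mdist point x + s).
have rt : r <= t by rewrite le_max lexx.
have t0 : 0 < t by exact: lt_le_trans rt.
apply: (null_restrict (s := t)); last by move=> v [].
have := mass_eq0 t0 (approximable_ball x s t0).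
rewrite -(momega_ball t0); last by rewrite le_max lexx orbT.
move=> /(_ xs0); apply: nullS => v [cv rv]; split; last first.
  exact: sub_Pi (fun i => le_ball rt) _ rv.
have [ov huv] := cell_diam cu cv (proj1 ux).
have [y vy] := std_exists ov.
rewrite proj_preimageE; exists y => //; rewrite ball_mdist /=.
by apply: le_lt_trans (huv _ _ ux vy) _; exact: hK.
Qed.

(** * The limit measure on the support *)

Local Notation Y := (spt_space Uomega m).

Lemma spt_distE (x y : Y) : mdist x y = mdist (set_val x : Xomega) (set_val y).
Proof. by []. Qed.

Lemma spt_pointE : set_val (point : Y) = point :> Xomega.
Proof. by []. Qed.

(** Over each cell having a point whose standard part is in [Y], one such standard part is picked. A
    ball around a support point has positive mass, so it contains the standard part, in [Y], of some
    [u] that does not evade the nets; the point picked over a small cell around [u] is then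
    close. *)
Lemma spt_separable : exists w : nat -> Y, w 0%N = point /\
  forall y (e : R), 0 < e -> exists n, mdist (w n) y < e.
Proof.
have [c nc] := evades_null.
pose g (kn : nat * nat) : Y :=
  xget point [set z : Y | exists2 v, cell c kn.1 kn.2 v & std v (set_val z)].
exists (fun j => if j is j'.+1 then if unpickle j' is Some kn then g kn else point
          else point); split => // y e e0.
(* The base point may have been added to the support, where positivity of the mass of balls fails;
   it is covered by the term of index 0. *)
have [yp|yp] := eqVneq (set_val y) (point : Xomega).
  by exists 0%N; rewrite spt_distE spt_pointE yp mdistxx.
have ys : spt_omega m (set_val y).
  have := set_valP y; case => // /eqP; rewrite /= => h; by rewrite h in yp.
have e2 : 0 < e / 2 by rewrite divr_gt0.
pose t := Num.max 1 (mdist point (set_val y) + e / 2).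
have t0 : 0 < t by rewrite lt_max ltr01.
have [u [uy nue nuS]] : exists u, [/\ proj_preimage (ball (set_val y) (e / 2)) u,
    ~ evades c u & ~ proj_preimage (~` spt_set) u].
  apply: contrapT => h; have := ys _ e2.
  rewrite (momega_ball t0) ?le_max ?lexx ?orbT//.
  have [B AB] := approximable_ball (set_val y) (e / 2) t0.
  suff -> : mass t (proj_preimage (ball (set_val y) (e / 2))) = 0%E by rewrite ltxx.
  apply/eqP; rewrite eq_le mass_ge0 andbT -(mass0 t0); apply: le_mass => //.
  - exact: approximable_ball.
  - exact: approximable_set0.
  - apply: nullS (nullU t0 (nc t t0) (cospt_null t0)) => u [[h1 h2] _].
    apply: contrapT => h3; apply: h; exists u; split => //.
      by move=> h4; apply: h3; left.
    by move=> h4; apply: h3; right.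
move: uy; rewrite proj_preimageE => -[x]; rewrite ball_mdist /= => yx ux.
have xS : spt_set x.
  apply: contrapT => xS; apply: nuS; rewrite proj_preimageE; by exists x.
have [K hK] := natSinv_lt_near e2.
have [k [n [Kk cu]]] : exists k n, (K <= k)%N /\ cell c k n u.
  apply: contrapT => h; apply: nue; exists K => k n Kk cu; apply: h.
  by exists k, n.
exists (pickle (k, n)).+1; rewrite pickleK spt_distE.
have [v cv vg] : exists2 v, cell c k n v & std v (set_val (g (k, n))).
  rewrite /g; case: xgetP => [z _ //|/(_ (SigSub (mem_set xS)))]; case.
  by exists u.
apply: le_lt_trans (metric_triangle _ x _) _.
rewrite metric_sym [e]splitr; apply: ltrD; last by rewrite metric_sym.
have [_ huv] := cell_diam cu cv (proj1 ux).
by apply: le_lt_trans (huv _ _ ux vg) _; exact: hK.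
Qed.

Definition lift (B : set Y) : set Xbar :=
  [set u | exists2 y, B y & std u (set_val y)].

Lemma liftE (B : set Y) : lift B = proj_preimage (set_val @` B).
Proof.
rewrite proj_preimageE; apply/seteqP; split => u.
  by move=> [y By uy]; exists (set_val y) => //; exists y.
by move=> [_ [y By <-] uy]; exists y.
Qed.

Lemma lift_val u (x : Xomega) : spt_set x -> std u x ->
  exists2 y : Y, set_val y = x & std u (set_val y).
Proof. by move=> xS ux; exists (SigSub (mem_set xS)). Qed.

Lemma lift_uniq u (y z : Y) : std u (set_val y) -> std u (set_val z) -> y = z.
Proof. by move=> uy uz; apply/val_inj/(std_uniq uy uz). Qed.

Lemma lift0 : lift set0 = set0.
Proof. by apply/seteqP; split => // u [y]. Qed.

Lemma lift_bigcup (F : nat -> set Y) : lift (\bigcup_n F n) = \bigcup_n lift (F n).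
Proof.
apply/seteqP; split => u; first by move=> [y [n _ Fy] uy]; exists n => //; exists y.
by move=> [n _ [y Fy uy]]; exists y => //; exists n.
Qed.

Lemma liftC (B : set Y) : lift (~` B) = lift setT `\` lift B.
Proof.
apply/seteqP; split => u.
  move=> [y By uy]; split; first by exists y.
  by move=> [z Bz uz]; apply: By; rewrite (lift_uniq uy uz).
by move=> [[y _ uy] nB]; exists y => // By; apply: nB; exists y.
Qed.

Lemma lift_ball (y : Y) (s : R) :
  lift (ball y s) = lift setT `&` proj_preimage (ball (set_val y) s).
Proof.
rewrite proj_preimageE; apply/seteqP; split => u.
  by move=> [z yz uz]; split; [exists z|exists (set_val z)].
move=> [[z _ uz] [x yx ux]]; exists z => //.
by move: yx; rewrite (std_uniq ux uz).
Qed.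

Lemma not_lift_setT u : Obar u -> ~ lift setT u -> proj_preimage (~` spt_set) u.
Proof.
move=> ou nu; rewrite proj_preimageE; have [x ux] := std_exists ou.
by exists x => // /lift_val/(_ ux)[y _ uy]; apply: nu; exists y.
Qed.

(** Almost every bounded point has its standard part in [Y]. This handles complements, since [liftC]
    is relative to [lift setT]. *)
Lemma approximable_lift_setT r : 0 < r -> approximable r (lift setT).
Proof.
move=> r0; rewrite -[lift _]setCK; apply: approximable_setC.
apply: approximable_null => //; apply: nullS (cospt_null r0) => u [nu ru].
by split => //; apply: not_lift_setT => //; exact: Pi_ball_Obar ru.
Qed.

Lemma approximable_lift r (B : set Y) : 0 < r -> measurable (B : set (borel Y)) ->
  approximable r (lift B).
Proof.
move=> r0; suff h : <<s @open Y >> `<=` [set B | approximable r (lift B)].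
  exact: h.
apply: smallest_sub.
  split => /=.
  - by rewrite lift0; exact: approximable_set0.
  - move=> A aA; rewrite setTD liftC; apply: approximable_setD => //.
    exact: approximable_lift_setT.
  - by move=> F aF; rewrite lift_bigcup; exact: approximable_bigcup.
move=> A oA /=; have [w [_ wd]] := spt_separable.
rewrite (open_bigcup_ball wd oA) lift_bigcup; apply: approximable_bigcup => // j.
case: unpickle => [kn|]; last by rewrite lift0; exact: approximable_set0.
case: asboolP => _; last by rewrite lift0; exact: approximable_set0.
rewrite lift_ball; apply: approximable_setI => //; last exact: approximable_ball.
exact: approximable_lift_setT.
Qed.

(** For each scale this provides a genuine finite measure, equal to [mspt] on Borel subsets of
    [ball point r] by [mspt_mass]; monotonicity, continuity from above and integration become
    available through it. *)
Lemma spt_measure r : 0 < r -> exists mu : {measure set (borel Y) -> \bar R},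
  forall B : set Y, mu B = mass r (lift B).
Proof.
move=> r0; pose f (B : set (borel Y)) := mass r (lift B).
have f0 : f set0 = 0%E by rewrite /f lift0 mass0.
have fge0 (A : set (borel Y)) : (0 <= f A)%E by exact: mass_ge0.
have fs : semi_sigma_additive f.
  move=> F mF tF _; rewrite /f lift_bigcup; apply: mass_semi_sigma_additive => //.
    by move=> n; exact: approximable_lift.
  move=> i j _ _ [u [[y Fy uy] [z Fz uz]]]; apply: tF => //.
  by exists y; split => //; rewrite (lift_uniq uy uz).
pose M := isMeasure.Build _ _ R f f0 fge0 fs.
by exists (HB.pack_for {measure set (borel Y) -> \bar R} f M : {measure set (borel Y) -> \bar R}).
Qed.

Lemma mspt_mass r (B : set Y) : 0 < r -> measurable (B : set (borel Y)) ->
  B `<=` ball point r -> mspt Uomega m B = mass r (lift B).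
Proof.
move=> r0 mB Br; rewrite /mspt /momega -liftE; apply: mbar_mass => //.
  rewrite liftE; apply: proj_preimage_sub => _ [y By <-].
  by have := Br _ By; rewrite !ball_mdist.
exact: approximable_lift.
Qed.

Lemma lift_setT_ae r (B : forall i, set (X i)) (Q : set Xbar) : 0 < r ->
  internal r B -> null r ((Pi B `&` lift setT) `\` Q) -> null r (Pi B `\` Q).
Proof.
move=> r0 iB h; apply: nullS (nullU r0 h (cospt_null r0)) => u [Bu Qu].
have ru := internal_Pi iB Bu.
have [Su|/not_lift_setT] := pselect (lift setT u); first by left.
by move=> h'; right; split => //; apply: h'; exact: Pi_ball_Obar ru.
Qed.

(** Points whose standard part is outside [Y] form a null set, so an internal set and a Borel set
    are compared only through standard parts lying in [Y]. *)
Lemma umass_le_mass r (D : forall i, set (X i)) (B : set Y) : 0 < r ->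
  internal r D -> measurable (B : set (borel Y)) ->
  (forall u y, Pi D u -> std u (set_val y) -> B y) ->
  (umass D <= mass r (lift B))%E.
Proof.
move=> r0 iD mB DB; rewrite -(mass_internal r0 iD); apply: le_mass => //.
- by exists D; exact: approximates_internal.
- exact: approximable_lift.
- apply: (@nullS _ _ (Pi D `\` lift B)); first by move=> u [[]].
  apply: lift_setT_ae => //; apply: nullS (null_set0 r0) => u [[Du [y _ uy]] Bu].
  by apply: Bu; exists y => //; exact: DB Du uy.
Qed.

(** The converse comparison; [N] will collect the points of the region missed by the nets. *)
Lemma mass_le_umass r (D : forall i, set (X i)) (B : set Y) N : 0 < r ->
  internal r D -> measurable (B : set (borel Y)) -> null r N ->
  (forall u y, B y -> std u (set_val y) -> Pball r u -> Pi D u \/ N u) ->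
  (mass r (lift B) <= umass D)%E.
Proof.
move=> r0 iD mB nN BD; rewrite -(mass_internal r0 iD); apply: le_mass => //.
- exact: approximable_lift.
- by exists D; exact: approximates_internal.
- by apply: nullS nN => u [[[y By uy] ru] nDu]; case: (BD u y By uy ru).
Qed.

(** The function [repr] recovers a family only up to almost everywhere equality. This notion
    attaches a standard part to the family itself. *)
Definition stdf (f : forall i, X i) x :=
  exists2 u, std u x & \forall i \near omega, repr u i = f i.

Lemma stdf_repr u x : std u x -> stdf (repr u) x.
Proof. by move=> ux; exists u => //; exact: nearW. Qed.

Lemma stdf_lt f g x y (c : R) : stdf f x -> stdf g y -> mdist x y < c ->
  \forall i \near omega, mdist (f i) (g i) < c.
Proof.
move=> [u ux uf] [v vy vg] /(std_dist_lt ux vy) h.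
by apply: filterS3 uf vg h => i -> ->.
Qed.

Lemma stdf_gt f g x y (c : R) : stdf f x -> stdf g y -> c < mdist x y ->
  \forall i \near omega, c < mdist (f i) (g i).
Proof.
move=> [u ux uf] [v vy vg] /(std_dist_gt ux vy) h.
by apply: filterS3 uf vg h => i -> ->.
Qed.

Lemma stdf_dist f g x y (c : R) : stdf f x -> stdf g y -> 0 < c ->
  \forall i \near omega, `|mdist (f i) (g i) - mdist x y| <= c.
Proof.
move=> fx gy c0.
have h1 : \forall i \near omega, mdist (f i) (g i) < mdist x y + c.
  by apply: (stdf_lt fx gy); rewrite ltrDl.
have h2 : \forall i \near omega, mdist x y - c < mdist (f i) (g i).
  by apply: (stdf_gt fx gy); rewrite ltrBlDr ltrDl.
apply: filterS2 h1 h2 => i a b; rewrite ler_distl.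
by rewrite (ltW b) (ltW a).
Qed.

(** Index 0 is the base point of [X i] for every [i], because the approximations must preserve base
    points exactly. *)
Definition wfam (w : nat -> Y) n i : X i :=
  if n is 0%N then point else repr (rep (set_val (w n))) i.

Lemma stdf_wfam w n : w 0%N = point -> stdf (wfam w n) (set_val (w n)).
Proof.
move=> w0; case: n => [|n].
  rewrite w0 spt_pointE; exists (pbar Uomega X); first exact: std_point.
  exact: repr_pi.
by exists (rep (set_val (w n.+1))); [exact: std_rep|exact: nearW].
Qed.

Lemma salgebra_bigsetU_ball w i N (d : R) :
  ball_salgebra (\big[setU/set0]_(n < N) ball (wfam w n i) d).
Proof.
by apply: (salgebra_bigsetU (F := fun n => ball (wfam w n i) d)) => n;
  exact: salgebra_ball.
Qed.

Lemma measurable_bigsetU_ball (w : nat -> Y) N (d : R) :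
  measurable (\big[setU/set0]_(n < N) ball (w n) d : set (borel Y)).
Proof.
apply: bigsetU_measurable => n _; apply: sub_sigma_algebra.
exact: open_metric_ball.
Qed.

(** By density the sets missed by the first balls decrease to the empty set, and continuity from
    above gives [N]. The standard part of an internal point missed by the balls in the [X i] is
    missed by those in [Y], so the same [N] works on both sides. *)
Lemma spt_nets (w : nat -> Y) (rho d : R) : w 0%N = point ->
  (forall y (e : R), 0 < e -> exists n, mdist (w n) y < e) -> 0 < rho -> 0 < d ->
  exists N,
    (mspt Uomega m (ball point rho `\` \big[setU/set0]_(n < N.+1) ball (w n) d)
      <= d%:E)%E /\
    \forall i \near omega,
      (m i (ball point rho `\` \big[setU/set0]_(n < N.+1) ball (wfam w n i) d)
        <= d%:E)%E.
Proof.
move=> w0 wd rho0 d0.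
(* The extra 1 makes room for standard parts at distance exactly [rho]. *)
pose r := rho + 1; have r0 : 0 < r by rewrite addr_gt0.
have [mu muE] := spt_measure r0.
pose C N : set (borel Y) := ball (point : Y) r `\` \big[setU/set0]_(n < N.+1) ball (w n) d.
have mball (y : Y) (s : R) : measurable (ball y s : set (borel Y)).
  by apply: sub_sigma_algebra; exact: open_metric_ball.
have mC N : measurable (C N).
  by apply: measurableD; [exact: mball|exact: measurable_bigsetU_ball].
have C0 : \bigcap_N C N = set0.
  apply/seteqP; split => // y hy; have [n wn] := wd y _ d0.
  have [_] := hy n Logic.I; apply.
  by rewrite -(bigcup_mkord n.+1 (fun n => ball (w n) d)); exists n => //=;
    rewrite ball_mdist.
have [N CN] : exists N, (mu (C N) < d%:E)%E.
  have : (mu \o C) x @[x --> \oo] --> mu (\bigcap_N C N).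
    apply: nonincreasing_cvg_mu => //.
    - rewrite muE -ge0_fin_numE ?mass_ge0//.
      by apply: mass_fin => //; exact: approximable_lift.
    - exact: bigcapT_measurable.
    - move=> k l kl; apply/subsetPset; apply: setDS.
      rewrite -(bigcup_mkord k.+1 (fun n => ball (w n) d)).
      rewrite -(bigcup_mkord l.+1 (fun n => ball (w n) d)).
      by move=> y [n /= nk]; exists n => //=; exact: leq_trans kl.
  rewrite C0 measure0 => /fine_cvgP[fC /cvgrPdist_lt/(_ d d0) hC].
  have [N [fN]] := filter_ex (filterI fC hC).
  rewrite /= sub0r normrN => h; exists N.
  rewrite -[mu _](fineK fN) lte_fin; apply: le_lt_trans h.
  exact: ler_norm.
have mCr : measurable
    (ball point rho `\` \big[setU/set0]_(n < N.+1) ball (w n) d : set (borel Y)).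
  by apply: measurableD; [exact: mball|exact: measurable_bigsetU_ball].
have rhor : rho <= r by rewrite lerDl.
exists N; split.
  rewrite (mspt_mass r0) //; last by move=> y [+ _]; exact: le_ball.
  rewrite -muE; apply/ltW/(le_lt_trans _ CN); apply: le_measure; rewrite ?inE//.
  by apply: setSD; exact: le_ball.
pose D i := ball (point : X i) rho `\` \big[setU/set0]_(n < N.+1) ball (wfam w n i) d.
have iD : internal r D.
  apply: internal_le rhor _; apply: internalD; first exact: internal_ball.
  by move=> i; exact: salgebra_bigsetU_ball.
suff : (umass D < d%:E)%E.
  by move=> /ulim_lt_near; apply: filterS => i; exact: ltW.
apply: le_lt_trans CN; rewrite muE; apply: umass_le_mass => // u y.
rewrite PiD => -[ru nu] uy; split.
  rewrite ball_mdist /=; apply: le_lt_trans (Pball_std uy ru) _.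
  by rewrite ltrDl.
rewrite -(bigcup_mkord N.+1 (fun n => ball (w n) d)) => -[n /= nN].
rewrite ball_mdist /= => wy; apply: nu.
rewrite (Pi_bigsetU (fun n i => ball (wfam w n i) d)).
rewrite -(bigcup_mkord N.+1 (fun n => Pi (fun i => ball (wfam w n i) d))).
exists n => //; have := stdf_lt (stdf_wfam n w0) (stdf_repr uy) wy.
by apply: filterS => i; rewrite ball_mdist.
Qed.

(** The first admissible index of the list is taken, not the closest one, so fibres are finite
    Boolean combinations of balls. *)
Fixpoint nearest (w : nat -> Y) i (d : R) (s : seq nat) (x : X i) : Y :=
  if s is n :: s' then
    if mdist (wfam w n i) x < d then w n else nearest w d s' x
  else point.

Lemma nearestP w i d s (x : X i) : (exists2 n, n \in s & mdist (wfam w n i) x < d) ->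
  exists n, [/\ n \in s, nearest w d s x = w n & mdist (wfam w n i) x < d].
Proof.
elim: s => [[]//|k s IH] [n] /=; case: ifPn => [kx _ _|nkx].
  by exists k; rewrite mem_head.
rewrite in_cons => /predU1P[->|ns nx]; first by rewrite (negbTE nkx).
have [|l [ls lE lx]] := IH; first by exists n.
by exists l; rewrite in_cons ls orbT.
Qed.

(** The map has finite range, so the preimage of an arbitrary [B] is built from finitely many balls
    by induction on the list. *)
Lemma salgebra_nearest w i d s (B : set Y) :
  ball_salgebra [set x : X i | B (nearest w d s x)].
Proof.
elim: s => [|n s IH] /=.
  have [Bp|nBp] := pselect (B point).
    rewrite (_ : [set _ | _] = ~` set0); first by apply: salgebraC; apply: salgebra0.
    by rewrite setC0; apply/seteqP; split.
  rewrite (_ : [set _ | _] = set0); first exact: salgebra0.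
  by apply/seteqP; split.
have sb : ball_salgebra (ball (wfam w n i) d) by exact: salgebra_ball.
have [Bn|nBn] := pselect (B (w n)).
  rewrite (_ : [set _ | _] = ball (wfam w n i) d `|` [set x | B (nearest w d s x)]).
    exact: salgebraU.
  rewrite ball_mdist; apply/seteqP; split => x /=; case: ifP => //.
  - by move=> _ _; left.
  - by move=> _ ?; right.
  - by move=> _ [].
rewrite (_ : [set _ | _] = [set x | B (nearest w d s x)] `\` ball (wfam w n i) d).
  exact: salgebraD.
rewrite ball_mdist; apply/seteqP; split => x /=; case: ifP => //.
- by move=> _ [] _ /(_ isT).
- by move=> _ [].
Qed.

Lemma ultra_forall_lt (P : nat -> nat -> Prop) K :
  (forall n, \forall i \near omega, P n i) ->
  \forall i \near omega, forall n, (n < K)%N -> P n i.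
Proof.
move=> nP; elim: K => [|K IH]; first by apply: nearW.
apply: filterS2 IH (nP K) => i h hK n; rewrite ltnS leq_eqVlt => /predU1P[->//|].
exact: h.
Qed.

(* The step sums of mesh [h] differ from the integrals by at most [h] times the
   total mass, and passing from [t <= g] to [t < g] costs one further layer. *)
Lemma layers_cvg (mu : {measure set (borel Y) -> \bar R}) (D : forall i, set (X i))
    (f : forall i, X i -> R) (g : Y -> R) (M : R) :
  (forall i, measurable (D i : set (borel (X i)))) ->
  (forall i, measurable_fun (D i : set (borel (X i))) (f i)) ->
  (forall i x, 0 <= f i x <= M) ->
  measurable_fun setT (g : borel Y -> R) -> (forall y, 0 <= g y <= M) ->
  (mu setT < +oo)%E ->
  (exists C : R, \forall i \near omega,
    (m i (D i `&` [set x | (0 < f i x)%R]) <= C%:E)%E) ->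
  (forall t, (0 < t)%R -> (ulim omega (fun i => m i (D i `&` [set x | (t < f i x)%R]))
    <= mu [set y | (t <= g y)%R])%E) ->
  (forall t, (0 < t)%R -> (mu [set y | (t < g y)%R] <=
    ulim omega (fun i => m i (D i `&` [set x | (t < f i x)%R])))%E) ->
  ulim omega (fun i => \int[m i]_(x in D i) (f i x)%:E)%E = (\int[mu]_y (g y)%:E)%E.
Proof.
move=> mD mf fM mg gM muT [C0 hC0] hU hL.
have mufin : mu setT \is a fin_num by rewrite ge0_fin_numE.
pose C := Num.max C0 0.
have C_ge0 : 0 <= C by rewrite le_max lexx orbT.
have hC : \forall i \near omega, (m i (D i `&` [set x | (0 < f i x)%R]) <= C%:E)%E.
  by apply: filterS hC0 => i /le_trans; apply; rewrite lee_fin le_max lexx.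
pose K := fine (mu setT).
have K_ge0 : 0 <= K by rewrite fine_ge0.
have bK (A : set (borel Y)) : measurable A -> (mu A <= K%:E)%E.
  by move=> mA; rewrite /K fineK//; apply: le_measure; rewrite ?inE.
have mgt t : measurable ([set y | (t < g y)%R] : set (borel Y)).
  by have := measurable_superlevel measurableT mg t; rewrite setTI.
have mge t : measurable ([set y | (t <= g y)%R] : set (borel Y)).
  rewrite (_ : [set y | _] = setT `&` g @^-1` `[t, +oo[); first exact: mg.
  by rewrite setTI; apply/seteqP; split => x /=; rewrite in_itv/= andbT.
have f0 i x : D i x -> 0 <= f i x by move=> _; have /andP[] := fM i x.
have g0 y : [set: borel Y] y -> 0 <= g y by move=> _; have /andP[] := gM y.
suff main (e : R) : 0 < e ->
    (ulim omega (fun i => \int[m i]_(x in D i) (f i x)%:E) <=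
      \int[mu]_y (g y)%:E + e%:E)%E /\
    (\int[mu]_y (g y)%:E <=
      ulim omega (fun i => \int[m i]_(x in D i) (f i x)%:E) + e%:E)%E.
  apply/eqP; rewrite eq_le; apply/andP; split; apply/lee_addgt0Pr => e e0;
    by have [] := main e e0.
move=> e0.
have CK : 0 < C + K + 1 by rewrite ltr_wpDl// addr_ge0.
(* The two bounds each lose one layer, of mass at most [C] for the [f i] and [K] for [g]; this mesh
   makes both losses at most [e], and the 1 keeps the denominator positive. *)
pose h := e / (C + K + 1).
have h0 : 0 < h by rewrite divr_gt0.
have hCK : h * C + h * K <= e.
  rewrite -mulrDr -[leRHS](divfK (lt0r_neq0 CK)) -/h ler_wpM2l ?ltW//.
  by rewrite ltrDl.
pose L := (Num.truncn (M / h)).+1.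
have ML : M <= L.+1%:R * h.
  rewrite -ler_pdivrMr//; apply/ltW/(lt_le_trans (truncnS_gt _)).
  by rewrite ler_nat.
have fL i x : D i x -> f i x <= L.+1%:R * h.
  by move=> _; have /andP[_ /le_trans] := fM i x; apply.
have gL y : [set: borel Y] y -> g y <= L.+1%:R * h.
  by move=> _; have /andP[_ /le_trans] := gM y; apply.
pose a j i := m i (D i `&` [set x | (j%:R * h < f i x)%R]).
pose b j := mu [set y | (j%:R * h < g y)%R].
have gle : (\int[mu]_y (g y)%:E <= \sum_(j < L.+1) h%:E * b j)%E.
  have := integral_le_layers mu measurableT mg h0 g0 gL.
  by under eq_bigr do rewrite setTI.
have gge : (\sum_(j < L) h%:E * b j.+1 <= \int[mu]_y (g y)%:E)%E.
  have := layers_le_integral mu measurableT mg h0 g0 L.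
  by under eq_bigr do rewrite setTI.
have a0 j i : (0 <= h%:E * a j i)%E by rewrite mule_ge0// lee_fin ltW.
have b0 j : (0 <= h%:E * b j)%E by rewrite mule_ge0// lee_fin ltW.
have hmul (u v : \bar R) : (u <= v)%E -> (h%:E * u <= h%:E * v)%E.
  by move=> uv; apply: lee_wpmul2l => //; rewrite lee_fin ltW.
have b0K : (h%:E * b 0%N <= (h * K)%:E)%E.
  by rewrite [(h * K)%:E]EFinM; apply: hmul; apply: bK; exact: mgt.
have ulimS : ulim omega (fun i => \sum_(j < L) h%:E * a j.+1 i)%E =
    (\sum_(j < L) h%:E * ulim omega (a j.+1))%E.
  rewrite (@ulim_sum R omega Uomega L (fun j i => h%:E * a j.+1 i)%E)//.
  by apply: eq_bigr => j _; rewrite ulimZ.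
split.
  (* Upper bound: the zeroth layer of the [f i] costs [h * C], and layer [j.+1] of the [f i] is
     compared with layer [j] of [g]. *)
  apply: (@le_trans _ _ (ulim omega
      (fun i => h%:E * a 0%N i + \sum_(j < L) h%:E * a j.+1 i)%E)).
    apply: le_ulim => i.
    have := integral_le_layers (m i) (mD i) (mf i) h0 (f0 i) (fL i).
    by rewrite big_ord_recl.
  have -> : ulim omega (fun i => h%:E * a 0%N i + \sum_(j < L) h%:E * a j.+1 i)%E =
      (ulim omega (fun i => h%:E * a 0%N i) +
       ulim omega (fun i => \sum_(j < L) h%:E * a j.+1 i))%E.
    by apply: ulimD => // i; exact: sume_ge0.
  rewrite ulimS.
  have h1 : (ulim omega (fun i => h%:E * a 0%N i) <= (h * C)%:E)%E.
    apply: ulim_le; apply: filterS hC => i hCi.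
    by rewrite [(h * C)%:E]EFinM; apply: hmul; rewrite /a mul0r.
  have h2 : (\sum_(j < L) h%:E * ulim omega (a j.+1) <= \sum_(j < L) h%:E * b j)%E.
    apply: lee_sum => j _; apply: hmul.
    apply: le_trans (hU _ _) _; first by rewrite mulr_gt0.
    apply: le_measure; rewrite ?inE// => y /=; apply: lt_le_trans.
    by rewrite ltr_pM2r// ltr_nat.
  have h3 : (\sum_(j < L) h%:E * b j <= (h * K)%:E + \int[mu]_y (g y)%:E)%E.
    apply: (@le_trans _ _ (\sum_(j < L.+1) h%:E * b j)%E).
      rewrite [leRHS]big_ord_recr /= -[leLHS]adde0; apply: leeD; [exact: lexx|exact: b0].
    by rewrite big_ord_recl; apply: leeD.
  apply: le_trans (leeD h1 (le_trans h2 h3)) _.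
  by rewrite addeA -EFinD addeC leeD2l// lee_fin.
(* Lower bound: the zeroth layer of [g] costs [h * K], and the other layers are compared index by
   index. *)
apply: le_trans gle _; rewrite big_ord_recl.
apply: (@le_trans _ _ ((h * K)%:E + ulim omega (fun i => \sum_(j < L) h%:E * a j.+1 i))%E).
  apply: leeD => //; rewrite ulimS; apply: lee_sum => j _.
  by apply: hmul; apply: hL; rewrite mulr_gt0.
rewrite addeC; apply: leeD.
  by apply: le_ulim => i; exact: (layers_le_integral (m i) (mD i) (mf i) h0 (f0 i) L).
rewrite lee_fin; apply: le_trans hCK.
by rewrite lerDr mulr_ge0// ltW.
Qed.

(** * The approximating maps *)

Section approximations.
Variables (w : nat -> Y) (z : nat -> Y) (N : nat -> nat).

Definition delta k : R := k.+1%:R^-1.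
(** The shift 5 keeps the radius above the error [delta k *+ 4], which is at most 4, as
    [weak_approx] demands. *)
Definition radius k : R := (k + 5)%:R.
Definition far_ball k i : set (X i) :=
  ball point (radius k) `\` \big[setU/set0]_(n < (N k).+1) ball (wfam w n i) (delta k).
Arguments far_ball : clear implicits.
(* The range [N k + k] ensures that each fixed [w n] is eventually compared with
   all the points in the range of [psi k i]. *)
Definition close k i :=
  (forall n n', (n < (N k + k).+1)%N -> (n' < (N k + k).+1)%N ->
    `|mdist (wfam w n i) (wfam w n' i) - mdist (w n) (w n')| <= delta k) /\
  (m i (far_ball k i) <= (delta k)%:E)%E.
(** The outside of the ball is sent to one point [z k], later taken far away when possible, so that
    the outer mass avoids the support of test functions. *)
Definition psi k i (x : X i) : Y :=
  if mdist point x < radius k then nearest w (delta k) (iota 0 (N k).+1) x else z k.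
Arguments psi : clear implicits.

Hypothesis w0 : w 0%N = point.
Hypothesis wdense : forall y (e : R), 0 < e -> exists n, mdist (w n) y < e.
Hypothesis hN : forall k,
  (mspt Uomega m (ball point (radius k) `\`
     \big[setU/set0]_(n < (N k).+1) ball (w n) (delta k)) <= (delta k)%:E)%E /\
  \forall i \near omega, (m i (far_ball k i) <= (delta k)%:E)%E.

Lemma delta_gt0 k : 0 < delta k. Proof. by rewrite invr_gt0. Qed.

Lemma delta_le1 k : delta k <= 1.
Proof. by rewrite invf_le1// ler1n. Qed.

Lemma radius_ge5 k : 5 <= radius k.
Proof. by rewrite ler_nat leq_addl. Qed.

Lemma salgebra_far_ball k i : ball_salgebra (far_ball k i).
Proof. by apply: salgebraD; [exact: salgebra_ball|exact: salgebra_bigsetU_ball]. Qed.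

Lemma close_near k : \forall i \near omega, close k i.
Proof.
have h : \forall i \near omega, forall n, (n < (N k + k).+1)%N ->
    forall n', (n' < (N k + k).+1)%N ->
    `|mdist (wfam w n i) (wfam w n' i) - mdist (w n) (w n')| <= delta k.
  apply: ultra_forall_lt => n; apply: ultra_forall_lt => n'.
  by apply: (stdf_dist (stdf_wfam n w0) (stdf_wfam n' w0)); exact: delta_gt0.
apply: filterS2 (proj2 (hN k)) h => i h2 h1; split => // n n' nk n'k.
exact: h1.
Qed.

Lemma salgebra_psi k i (B : set Y) : ball_salgebra [set x | B (psi k i x)].
Proof.
have sb : ball_salgebra (ball (point : X i) (radius k)) by exact: salgebra_ball.
rewrite /psi; move: (iota _ _) => s.
have sn := @salgebra_nearest w i (delta k) s B.
have [Bz|nBz] := pselect (B (z k)).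
  rewrite (_ : [set x | _] = ~` ball point (radius k) `|`
      [set x | B (nearest w (delta k) s x)] `&` ball point (radius k)).
    by apply: salgebraU; [exact: salgebraC|exact: salgebraI].
  rewrite ball_mdist; apply/seteqP; split => x /=; case: ifP => //.
  - by move=> ? ?; right.
  - by move=> _ _; left.
  - by move=> _ [|[]].
rewrite (_ : [set x | _] =
    [set x | B (nearest w (delta k) s x)] `&` ball point (radius k)).
  exact: salgebraI.
rewrite ball_mdist; apply/seteqP; split => x /=; case: ifP => //.
  by move=> _ [].
by move=> _ [].
Qed.

Lemma psi_near k i (x : X i) : ball point (radius k) x -> ~ far_ball k i x ->
  exists n, [/\ (n < (N k).+1)%N, psi k i x = w n & mdist (wfam w n i) x < delta k].
Proof.
rewrite /far_ball ball_mdist /= => xk h.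
have [n /= nN] : (\bigcup_(n < (N k).+1) ball (wfam w n i) (delta k)) x.
  by apply: contrapT; rewrite bigcup_mkord => h'; apply: h.
rewrite ball_mdist /= => nx; rewrite /psi xk.
have [|l []] := @nearestP w i (delta k) (iota 0 (N k).+1) x.
  by exists n => //; rewrite mem_iota.
by rewrite mem_iota /= => lN lE lx; exists l.
Qed.

Lemma near_not_far k i (x : X i) n : (n < (N k).+1)%N ->
  mdist (wfam w n i) x < delta k -> ~ far_ball k i x.
Proof.
move=> nN nx [_]; rewrite -(bigcup_mkord _ (fun n => ball (wfam w n i) (delta k))).
by apply; exists n => //=; rewrite ball_mdist.
Qed.

Lemma psi_weak_approx k i : close k i ->
  weak_approx (m i) (mspt Uomega m) (radius k) (delta k *+ 4) (psi k i).
Proof.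
move=> [hd hm].
have d0 := delta_gt0 k; have d1 := delta_le1 k; have r5 := radius_ge5 k.
have rp : 0 < radius k by apply: lt_le_trans r5.
have d34 : delta k *+ 3 < delta k *+ 4 by rewrite ltr_pMn2l.
have in0 n : (n < (N k).+1)%N -> (n < (N k + k).+1)%N.
  by move=> /leq_trans; apply; rewrite ltnS leq_addr.
split.
- by rewrite mulrn_wgt0.
- apply: lt_le_trans r5; apply: le_lt_trans (_ : 4 < 5); last by rewrite ltr_nat.
  lra.
- move=> _ B _; rewrite setTI; apply: salgebra_measurable; exact: salgebra_psi.
- rewrite /psi mdistxx rp /= mdistxx d0; exact: w0.
exists (ball point (radius k) `\` far_ball k i); split.
- by apply: salgebra_measurable; apply: salgebraD;
    [exact: salgebra_ball|exact: salgebra_far_ball].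
- by move=> x [].
- split; first by rewrite ball_mdist /= mdistxx.
  by apply: (@near_not_far _ _ _ 0%N); rewrite //= mdistxx.
(* Replacing [x] and [y] by net points costs less than [delta k] each, and passing to [Y] at most
   [delta k]: in all less than [delta k *+ 3]. *)
- move=> x y [kx nx] [ky ny].
  have [n [nN -> nx']] := psi_near kx nx.
  have [l [lN -> ly]] := psi_near ky ny.
  have := hd n l (in0 _ nN) (in0 _ lN).
  have h1 := metric_triangle x (wfam w n i) y.
  have h2 := metric_triangle (wfam w n i) (wfam w l i) y.
  have h3 := metric_triangle (wfam w n i) x (wfam w l i).
  have h4 := metric_triangle x y (wfam w l i).
  move: nx' ly h1 h2 h3 h4.
  rewrite (metric_sym x (wfam w n i)) (metric_sym y (wfam w l i)).
  rewrite !ler_norml => nx' ly h1 h2 h3 h4 /andP[h5 h6].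
  apply/andP; split; rewrite mulrS mulr2n in d34 *; lra.
split.
  rewrite setDD setIidr; last by move=> x [].
  apply: le_trans hm _; rewrite lee_fin -[leLHS]mulr1n ler_wpMn2l// ltW//.
have rk : radius k - delta k *+ 4 <= radius k by rewrite lerBlDr lerDl mulrn_wge0// ltW.
have mball (y : Y) (s : R) : measurable (ball y s : set (borel Y)).
  by apply: sub_sigma_algebra; exact: open_metric_ball.
have [mu muE] := spt_measure rp.
have m1 : measurable (ball point (radius k - delta k *+ 4) `\`
    thickening (psi k i @` (ball point (radius k) `\` far_ball k i)) (delta k *+ 4)
    : set (borel Y)).
  by apply: measurableD => //; apply: sub_sigma_algebra; exact: thickening_open.
have m2 : measurable (ball point (radius k) `\`
    \big[setU/set0]_(n < (N k).+1) ball (w n) (delta k) : set (borel Y)).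
  by apply: measurableD => //; exact: measurable_bigsetU_ball.
apply: (@le_trans _ _ (delta k)%:E); last first.
  by rewrite lee_fin -[leLHS]mulr1n ler_wpMn2l// ltW.
apply: le_trans (proj1 (hN k)).
rewrite (mspt_mass rp m1); last by move=> y [+ _]; exact: le_ball.
rewrite (mspt_mass rp m2); last by move=> y [].
rewrite -!muE; apply: le_measure; rewrite ?inE// => y [yk nty].
(* If [y] is near [w n], the representative of [w n] is still in the ball, as the shrinking by
   [delta k *+ 4] leaves room for two errors. Its image [w l] is within two errors of [w n], hence
   within three of [y]. *)
split; first exact: le_ball rk _ yk.
rewrite -(bigcup_mkord _ (fun n => ball (w n) (delta k))) => -[n /= nN].
rewrite ball_mdist /= => wy; apply: nty.
have := hd 0%N n (ltn0Sn _) (in0 _ nN); rewrite w0 /= ler_norml => /andP[_ pn].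
move: yk; rewrite ball_mdist /= => yk.
have t1 := metric_triangle (point : Y) y (w n).
have wk : ball point (radius k) (wfam w n i).
  rewrite ball_mdist /=; move: t1 wy yk pn; rewrite (metric_sym y (w n)).
  rewrite mulrS mulrS mulr2n; lra.
have nw : ~ far_ball k i (wfam w n i).
  by apply: (near_not_far nN); rewrite mdistxx.
have [l [lN lE lw]] := psi_near wk nw.
apply: (@thickeningP _ _ _ _ (w l)); first by exists (wfam w n i).
have := hd l n (in0 _ lN) (in0 _ nN); rewrite ler_norml => /andP[h5 h6].
have t2 := metric_triangle (w l) (w n) y.
move: t2 h5 wy lw; rewrite mulrS mulrS mulr2n; lra.
Qed.

Variable kappa : nat -> nat.
Hypothesis kappa_ge : forall K, \forall i \near omega, (K <= kappa i)%N.
Hypothesis kappa_close : \forall i \near omega, close (kappa i) i.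

Lemma delta_kappa (e : R) : 0 < e -> \forall i \near omega, delta (kappa i) *+ 2 < e.
Proof.
by move=> /natSinv_lt_near[K hK]; apply: filterS (kappa_ge K) => i; exact: hK.
Qed.

(** The index selected by [psi] varies with [i], so distances are compared through one fixed [w n0]
    near [y], to which [close] applies once [n0 <= kappa i]. *)
Lemma psi_std u (y : Y) (e : R) : std u (set_val y) ->
  (\forall i \near omega, ball point (radius (kappa i)) (repr u i)) ->
  (\forall i \near omega, ~ far_ball (kappa i) i (repr u i)) -> 0 < e ->
  \forall i \near omega, mdist y (psi (kappa i) i (repr u i)) < e.
Proof.
move=> uy hb hf e0.
have e4 : 0 < e / 4 by rewrite divr_gt0.
have [n0 wn0] := wdense y e4.
have h0 := stdf_lt (stdf_wfam n0 w0) (stdf_repr uy) wn0.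
near=> i.
have iclose : close (kappa i) i by near: i.
have ib : ball point (radius (kappa i)) (repr u i) by near: i.
have ifar : ~ far_ball (kappa i) i (repr u i) by near: i.
have i0 : mdist (wfam w n0 i) (repr u i) < e / 4 by near: i.
have id : delta (kappa i) *+ 2 < e / 4 by near: i; exact: delta_kappa.
have in0 : (n0 <= kappa i)%N by near: i.
have [n [nN -> nu]] := psi_near ib ifar.
have [+ _] := iclose => /(_ n n0).
have -> : (n < (N (kappa i) + kappa i).+1)%N.
  by apply: leq_trans nN _; rewrite ltnS leq_addr.
have -> : (n0 < (N (kappa i) + kappa i).+1)%N.
  by rewrite ltnS (leq_trans in0)// leq_addl.
move=> /(_ isT isT); rewrite ler_norml => /andP[h5 _].
have t1 := metric_triangle y (w n0) (w n).
have t2 := metric_triangle (wfam w n i) (repr u i) (wfam w n0 i).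
move: t1 t2 h5 nu i0 wn0 id; rewrite (metric_sym y (w n0)) (metric_sym (w n0) (w n)).
rewrite (metric_sym (repr u i)) mulr2n; lra.
Unshelve. all: by end_near. Qed.

(** * Convergence of the integrals of test functions *)

Local Notation Psi i := (psi (kappa i) i).
Local Notation B_ i := (ball (point : X i) (radius (kappa i))).

Lemma near_radius (c : R) : \forall i \near omega, c < radius (kappa i).
Proof.
apply: filterS (kappa_ge (Num.truncn c)) => i hi.
apply: lt_le_trans (truncnS_gt c) _; rewrite ler_nat.
by rewrite (leq_trans (_ : _ <= (kappa i).+1)%N)// -addn1 leq_add2l.
Qed.

Lemma far_ball_mass : ulim omega (fun i => m i (far_ball (kappa i) i)) = 0%E.
Proof.
apply/eqP; rewrite eq_le ulim_ge0// andbT; apply/lee_addgt0Pr => e e0.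
rewrite add0e; apply: ulim_le; apply: filterS2 kappa_close (delta_kappa e0) => i [_ h] de.
apply: le_trans h _; rewrite lee_fin ltW//; apply: le_lt_trans de.
by rewrite mulr2n lerDl ltW// delta_gt0.
Qed.

Lemma measurable_psi i (phi : Y -> R) (D : set (X i)) :
  measurable (D : set (borel (X i))) ->
  measurable_fun (D : set (borel (X i))) (fun x => phi (Psi i x)).
Proof.
move=> mD _ B _; apply: measurableI => //; apply: salgebra_measurable.
exact: (@salgebra_psi (kappa i) i [set y | B (phi y)]).
Qed.

Lemma salgebra_superlevel i (phi : Y -> R) (t : R) :
  ball_salgebra (B_ i `&` [set x | t < phi (Psi i x)]).
Proof.
apply: salgebraI; first exact: salgebra_ball.
exact: (@salgebra_psi (kappa i) i [set y | t < phi y]).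
Qed.

(** The measure depends on [rho0] only, so one measure serves a test function and its positive and
    negative parts. *)
Lemma Cbbs_cvg_ball (rho0 : R) :
  exists mu : {measure set (borel Y) -> \bar R}, [/\ (mu setT < +oo)%E,
    forall phi : Y -> R, [set y | phi y != 0] `<=` ball point rho0 ->
      (\int[mspt Uomega m]_y (phi y)%:E = \int[mu]_y (phi y)%:E)%E &
    forall phi : Y -> R, Cbbs phi -> [set y | phi y != 0] `<=` ball point rho0 ->
      (forall y, 0 <= phi y) ->
      ulim omega (fun i => \int[m i]_(x in B_ i) (phi (Psi i x))%:E)%E =
        (\int[mu]_y (phi y)%:E)%E].
Proof.
pose rho := Num.max rho0 1.
(* A point outside [far_ball] whose image is at distance less than [rho] is within [rho] plus two
   errors [delta], each at most 1. *)
pose r := rho + 2.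
have rho_gt0 : 0 < rho by rewrite lt_max ltr01 orbT.
have r0 : 0 < r by rewrite addr_gt0.
have [mu muE] := spt_measure r0.
have muT : (mu setT < +oo)%E.
  rewrite muE -ge0_fin_numE ?mass_ge0//; apply: mass_fin => //.
  exact: approximable_lift.
have hrho (phi : Y -> R) : [set y | phi y != 0] `<=` ball point rho0 ->
    forall y, phi y != 0 -> mdist point y < rho.
  move=> hphi y /hphi; rewrite ball_mdist /= => h.
  by apply: lt_le_trans h _; rewrite le_max lexx.
exists mu; split => // phi.
  move=> /hrho {}hrho.
  apply: (@eq_setfun_integral _ (borel Y) R mu (mspt Uomega m)
    (ball (point : Y) r : set (borel Y))).
    by move=> A mA Ar; rewrite muE; exact: mspt_mass.
  move=> y; rewrite ball_mdist /= => yr; congr EFin; apply/eqP.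
  apply: contrapT => /negP /hrho yrho; apply: yr.
  by apply: lt_trans yrho _; rewrite ltrDl.
move=> [cphi [M0 hM0] _] /hrho {}hrho phi0.
have hM y : 0 <= phi y <= M0.
  by rewrite phi0/=; apply: le_trans (hM0 y); exact: ler_norm.
have mphi := continuous_borel_measurable cphi.
pose F t i := B_ i `&` [set x | t < phi (Psi i x)].
(* Cutting to a fixed ball and discarding [far_ball] makes the superlevel sets internal at scale
   [r]; for [0 <= t] the ultralimit of the masses is not lowered. *)
pose F' t i := ball (point : X i) r `&` (F t i `\` far_ball (kappa i) i).
have sF t : salg (F t) by move=> i; exact: salgebra_superlevel.
have sfar : salg (fun i => far_ball (kappa i) i).
  by move=> i; exact: salgebra_far_ball.
have iF' t : internal r (F' t).
  apply: internalI; first exact: internal_ball.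
  by move=> i; apply: salgebraD; [exact: sF|exact: sfar].
have Fr t : 0 <= t -> \forall i \near omega,
    F t i `<=` F' t i `|` far_ball (kappa i) i.
  move=> t0; apply: filterS kappa_close => i [hd _] x Fx.
  have [fx|nfx] := pselect (far_ball (kappa i) i x); [by right|left].
  split => //; have [xB tx] := Fx.
  have [n [nN nE nx]] := psi_near xB nfx.
  have := hd 0%N n (ltn0Sn _).
  have -> : (n < (N (kappa i) + kappa i).+1)%N.
    by apply: leq_trans nN _; rewrite ltnS leq_addr.
  move=> /(_ isT); rewrite w0 /= ler_norml => /andP[_ h].
  have := hrho (w n); rewrite -nE => /(_ (lt0r_neq0 (le_lt_trans t0 tx))); rewrite nE => wr.
  rewrite ball_mdist /=; have t1 := metric_triangle point (wfam w n i) x.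
  have d1 := delta_le1 (kappa i).
  by rewrite /r; move: t1 h wr nx d1; lra.
have mFi t i : measurable (F t i : set (borel (X i))).
  by apply: salgebra_measurable; exact: sF.
have mF'i t i : measurable (F' t i : set (borel (X i))).
  by apply: salgebra_measurable; exact: (internal_salg (iF' t)).
have mfar i : measurable (far_ball (kappa i) i : set (borel (X i))).
  by apply: salgebra_measurable; exact: sfar.
have mF t : 0 <= t -> (ulim omega (fun i => m i (F t i)) <= umass (F' t))%E.
  move=> t0; rewrite -[leRHS]adde0 -far_ball_mass -ulimD//.
  apply: le_ulim_near; apply: filterS (Fr t t0) => i Fi /=.
  apply: (@le_trans _ _ (m i (F' t i `|` far_ball (kappa i) i))).
    apply: le_measure => //; rewrite inE; first exact: mFi.
    by apply: measurableU; [exact: mF'i|exact: mfar].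
  by apply: measureU2; [exact: mF'i|exact: mfar].
have stdlim u (y : Y) : std u (set_val y) -> (\forall i \near omega, B_ i (repr u i)) ->
    (\forall i \near omega, ~ far_ball (kappa i) i (repr u i)) ->
    forall V : set Y, nbhs y V -> \forall i \near omega, V (Psi i (repr u i)).
  move=> uy hb hf V /nbhs_ballP[e /= e0 eA].
  apply: filterS (psi_std uy hb hf e0) => i h; apply: eA.
  by rewrite ball_mdist.
apply: (layers_cvg (M := M0)) => //.
- by move=> i; apply: salgebra_measurable; exact: salgebra_ball.
- by move=> i; apply: measurable_psi; apply: salgebra_measurable; exact: salgebra_ball.
- have := umass_fin r0 (iF' 0); move=> /fineK E.
  exists (fine (umass (F' 0)) + 1).
  have : (ulim omega (fun i => m i (F 0%R i)) < (fine (umass (F' 0%R)) + 1)%:E)%E.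
    by apply: le_lt_trans (mF 0 (lexx _)) _; rewrite EFinD E lteDl ?lte_fin// -E.
  by move=> /ulim_lt_near; apply: filterS => i /ltW.
- move=> t t0; apply: le_trans (mF t (ltW t0)) _; rewrite muE.
  apply: umass_le_mass => //.
    rewrite (_ : [set y | _] = setT `&` phi @^-1` `[t, +oo[); first exact: mphi.
    by rewrite setTI; apply/seteqP; split => x /=; rewrite in_itv/= andbT.
  (* If [phi y < t], continuity would put the images of [u] below [t], against membership in [F' t];
     hence the weak inequality [t <= phi y] in the limit. *)
  move=> u y uF uy; rewrite /= leNgt; apply/negP => yt.
  have hb : \forall i \near omega, B_ i (repr u i).
    by apply: filterS uF => i [_ [[]]].
  have hf : \forall i \near omega, ~ far_ball (kappa i) i (repr u i).
    by apply: filterS uF => i [_ []].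
  have yA : nbhs (y : Y) [set y' : Y | phi y' < t] := cphi (y : Y) _ (lt_nbhsl yt).
  have hA := stdlim u y uy hb hf _ yA.
  apply: (ultra_not_both Uomega hA); apply: filterS uF => i [_ [[_ /= h1] _]].
  by apply/negP; rewrite -leNgt ltW.
- move=> t t0; apply: (@le_trans _ _ (umass (F' t))); last first.
    apply: le_ulim => i; apply: le_measure; rewrite ?inE; last by move=> x [_ []].
      exact: mF'i.
    exact: mFi.
  (* For points in [far_ball] the images need not converge to the standard part; they form the null
     exceptional set. *)
  pose E i := ball (point : X i) r `&` far_ball (kappa i) i.
  have iE : internal r E by apply: internalI => //; exact: internal_ball.
  rewrite muE; apply: (mass_le_umass (N := Pi E)) => //.
  + by have := measurable_superlevel measurableT mphi t; rewrite setTI.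
  + apply: umass0_null => //; apply/eqP; rewrite eq_le umass_ge0 andbT.
    rewrite -far_ball_mass; apply: le_ulim => i; apply: le_measure; rewrite ?inE.
    * by apply: salgebra_measurable; exact: (internal_salg iE).
    * exact: mfar.
    * by move=> x [].
  + move=> u y /= ty uy ru.
    have [hf|hf] := ultra_dec Uomega (fun i => far_ball (kappa i) i (repr u i)).
      by right; apply: filterS2 ru hf.
    left.
    have hb : \forall i \near omega, B_ i (repr u i).
      by apply: filterS2 ru (near_radius r) => i + /ltW ri; exact: le_ball.
    have yA : nbhs (y : Y) [set y' : Y | t < phi y'] := cphi (y : Y) _ (lt_nbhsr ty).
    have hA := stdlim u y uy hb hf _ yA.
    by apply: filterS (filterI ru (filterI hb (filterI hf hA))) => i [? [? []]].
Qed.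

Lemma Cbbs_max0 (phi : Y -> R) : Cbbs phi -> Cbbs (fun y => Num.max (phi y) 0).
Proof.
move=> [cphi [M hM] [rho hrho]]; split.
- move=> y; apply: (@continuous_max R Y phi (fun=> 0)); first exact: cphi.
  exact: cst_continuous.
- exists M => y; apply: le_trans (hM y).
  by rewrite ger0_norm ?le_max ?lexx ?orbT// ge_max ler_norm normr_ge0.
- exists rho => y /= h; apply: hrho; apply: contra_neq h => ->.
  by rewrite maxxx.
Qed.

Lemma CbbsN (phi : Y -> R) : Cbbs phi -> Cbbs (fun y => - phi y).
Proof.
move=> [cphi [M hM] [rho hrho]]; split.
- by move=> y; exact: (cvgN (cphi y)).
- by exists M => y; rewrite normrN.
- by exists rho => y /=; rewrite oppr_eq0; exact: hrho.
Qed.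

(** Both parts of [phi] have finite limit integrals, so the limits may be subtracted. The domain [D]
    is a parameter because the lemma serves both the balls and the whole spaces. *)
Lemma Cbbs_cvg_signed (D : forall i, set (X i)) (rho : R)
    (mu : {measure set (borel Y) -> \bar R}) : (mu setT < +oo)%E ->
  (forall phi : Y -> R, Cbbs phi -> [set y | phi y != 0] `<=` ball point rho ->
    (forall y, 0 <= phi y) ->
    ulim omega (fun i => \int[m i]_(x in D i) (phi (Psi i x))%:E)%E =
      (\int[mu]_y (phi y)%:E)%E) ->
  forall phi : Y -> R, Cbbs phi -> [set y | phi y != 0] `<=` ball point rho ->
    (\int[m i]_(x in D i) (phi (Psi i x))%:E)%E @[i --> omega] -->
      (\int[mu]_y (phi y)%:E)%E.
Proof.
move=> muT h phi Cphi sphi.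
have pos (psi : Y -> R) : Cbbs psi -> [set y | psi y != 0] `<=` ball point rho ->
    ulim omega (fun i => \int[m i]_(x in D i) (Num.max (psi (Psi i x)) 0)%:E)%E =
      (\int[mu]_y (Num.max (psi y) 0)%:E)%E.
  move=> Cpsi spsi; apply: (h (fun y => Num.max (psi y) 0)).
  - exact: Cbbs_max0.
  - by move=> y /= hy; apply: spsi; apply: contra_neq hy => ->; rewrite maxxx.
  - by move=> y; rewrite le_max lexx orbT.
have fin (psi : Y -> R) : Cbbs psi ->
    (\int[mu]_y (Num.max (psi y) 0)%:E)%E \is a fin_num.
  move=> /Cbbs_max0[cpsi [M hM] _].
  have psi0 y : 0 <= Num.max (psi y) 0 by rewrite le_max lexx orbT.
  rewrite ge0_fin_numE; last by apply: integral_ge0 => y _; rewrite lee_fin.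
  have mufin : mu setT \is a fin_num by rewrite ge0_fin_numE.
  apply: (@le_lt_trans _ _ (\int[mu]_y (cst M%:E y))%E).
    apply: ge0_le_integral => //.
    - by move=> y _; rewrite lee_fin.
    - by apply/measurable_EFinP; exact: continuous_borel_measurable.
    - by move=> y _; rewrite lee_fin; apply: le_trans (hM y); exact: ler_norm.
  by rewrite integral_cst// -(fineK mufin) -EFinM ltry.
rewrite (integral_max0 mu).
under eq_fun do rewrite integral_max0.
have sphiN : [set y | - phi y != 0] `<=` ball point rho.
  by move=> y /=; rewrite oppr_eq0; exact: sphi.
have finN := fin _ (CbbsN Cphi).
apply: cvgeB.
- by rewrite fin_num_adde_defl// fin_numN.
- by apply: cvg_ulim; exact: pos.
- by apply: cvg_ulim; exact: (pos (fun y => - phi y) (CbbsN Cphi)).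
Qed.

Hypothesis z_far : unbounded_space Y -> forall k, radius k < mdist point (z k).

(** On the complement of the ball the integrand is the constant [phi (z (kappa i))]. It is
    eventually 0 when [Y] is unbounded; under [no_mass_escape] it is bounded and the mass of the
    complement tends to 0. *)
Lemma tail_vanishes (phi : Y -> R) : Cbbs phi -> (forall y, 0 <= phi y) ->
  unbounded_space Y \/ no_mass_escape omega m ->
  ulim omega (fun i => \int[m i]_(x in ~` B_ i) (phi (Psi i x))%:E)%E = 0%E.
Proof.
move=> [cphi [M hM] [rho hrho]] phi0 hyp.
have tailE i : (\int[m i]_(x in ~` B_ i) (phi (Psi i x))%:E =
    (phi (z (kappa i)))%:E * m i (~` B_ i))%E.
  rewrite -integral_cst; last first.
    by apply: salgebra_measurable; apply: salgebraC; exact: salgebra_ball.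
  apply: eq_integral => x; rewrite inE ball_mdist /= => /negP nx.
  by rewrite /psi (negbTE nx).
rewrite (_ : (fun i => _) = (fun i => (phi (z (kappa i)))%:E * m i (~` B_ i))%E);
  last by apply/funext.
apply/eqP; rewrite eq_le; apply/andP; split; last first.
  by apply: ulim_ge0 => i; rewrite mule_ge0// lee_fin.
apply/lee_addgt0Pr => e e0; rewrite add0e; apply: ulim_le.
case: hyp => [unb|esc].
  apply: filterS (near_radius rho) => i ri.
  suff -> : phi (z (kappa i)) = 0 by rewrite mul0e lee_fin ltW.
  apply/eqP; apply: contrapT => /negP /hrho; rewrite ball_mdist /=.
  by apply/negP; rewrite -leNgt ltW// (lt_trans ri)// z_far.
have M0 : 0 <= M by apply: le_trans (hM point).
have M1 : 0 < M + 1 by rewrite ltr_wpDl.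
have [r hr] := esc (e / (M + 1)) (divr_gt0 e0 M1).
apply: filterS2 hr (near_radius r) => i hi ri.
apply: (@le_trans _ _ (M%:E * (e / (M + 1))%:E)%E).
  apply: lee_pmul => //; first by rewrite lee_fin.
    by rewrite lee_fin; apply: le_trans (hM _); exact: ler_norm.
  apply: le_trans hi; apply: le_measure; rewrite ?inE;
    try by apply: salgebra_measurable; apply: salgebraC; exact: salgebra_ball.
  by apply: subsetC; apply: le_ball; exact: ltW.
rewrite -EFinM lee_fin mulrA ler_pdivrMr// mulrC ler_pM2l// lerDl//.
Qed.

Lemma Cbbs_cvg_full (rho : R) (mu : {measure set (borel Y) -> \bar R}) :
  unbounded_space Y \/ no_mass_escape omega m ->
  (forall phi : Y -> R, Cbbs phi -> [set y | phi y != 0] `<=` ball point rho ->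
    (forall y, 0 <= phi y) ->
    ulim omega (fun i => \int[m i]_(x in B_ i) (phi (Psi i x))%:E)%E =
      (\int[mu]_y (phi y)%:E)%E) ->
  forall phi : Y -> R, Cbbs phi -> [set y | phi y != 0] `<=` ball point rho ->
    (forall y, 0 <= phi y) ->
    ulim omega (fun i => \int[m i]_x (phi (Psi i x))%:E)%E =
      (\int[mu]_y (phi y)%:E)%E.
Proof.
move=> hyp h phi Cphi sphi phi0.
have mB i : measurable (B_ i : set (borel (X i))).
  by apply: salgebra_measurable; exact: salgebra_ball.
rewrite -(h phi Cphi sphi phi0) -[RHS]adde0 -(tail_vanishes Cphi phi0 hyp) -ulimD.
- congr ulim; apply/funext => i /=; rewrite -[in LHS](setUv (B_ i)).
  rewrite (ge0_integral_setU _ (mB i) (measurableC (mB i)))//.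
  + rewrite setUv; apply/measurable_EFinP; exact: measurable_psi.
  + by move=> x _; rewrite lee_fin.
  + by apply/disj_setPS; rewrite setICr.
- by move=> i; apply: integral_ge0 => x _; rewrite lee_fin.
- by move=> i; apply: integral_ge0 => x _; rewrite lee_fin.
Qed.

Lemma psi_cvg : forall phi : Y -> R, Cbbs phi ->
  (\int[m i]_(x in B_ i) (phi (Psi i x))%:E)%E @[i --> omega] -->
    (\int[mspt Uomega m]_y (phi y)%:E)%E /\
  (unbounded_space Y \/ no_mass_escape omega m ->
    (\int[m i]_x (phi (Psi i x))%:E)%E @[i --> omega] -->
      (\int[mspt Uomega m]_y (phi y)%:E)%E).
Proof.
move=> phi Cphi; have [_ _ [rho hrho]] := Cphi.
have [mu [muT muE hmu]] := Cbbs_cvg_ball rho.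
rewrite (muE phi hrho); split; first exact: (Cbbs_cvg_signed muT hmu Cphi hrho).
move=> hyp; have hT := Cbbs_cvg_full hyp hmu.
exact: (Cbbs_cvg_signed muT (D := fun i => setT) hT Cphi hrho).
Qed.

End approximations.

Lemma weak_approximations : exists (r e : nat -> R) (psi : forall i, X i -> Y),
  [/\ forall i, 0 < r i /\ 0 < e i,
      r i @[i --> omega] --> +oo,
      e i @[i --> omega] --> 0,
      \forall i \near omega,
        weak_approx (m i) (mspt Uomega m) (r i) (e i) (psi i) &
      forall phi : Y -> R, Cbbs phi ->
        (\int[m i]_(x in ball point (r i)) (phi (psi i x))%:E)%E
          @[i --> omega] --> (\int[mspt Uomega m]_y (phi y)%:E)%E /\
        (unbounded_space Y \/ no_mass_escape omega m ->
          (\int[m i]_x (phi (psi i x))%:E)%E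
            @[i --> omega] --> (\int[mspt Uomega m]_y (phi y)%:E)%E)].
Proof.
have [w [w0 wd]] := spt_separable.
have nets k : exists N, (mspt Uomega m (ball point (radius k) `\`
      \big[setU/set0]_(n < N.+1) ball (w n) (delta k)) <= (delta k)%:E)%E /\
    \forall i \near omega, (m i (ball point (radius k) `\`
      \big[setU/set0]_(n < N.+1) ball (wfam w n i) (delta k)) <= (delta k)%:E)%E.
  by apply: spt_nets => //; [rewrite ltr0n addn_gt0 orbT|exact: delta_gt0].
have [N hN] := choice nets.
(* The default [point] is used only when no point of [Y] is farther than [radius k]. *)
pose z k : Y := xget point [set y | radius k < mdist point y].
have z_far : unbounded_space Y -> forall k, radius k < mdist point (z k).
  move=> unb k; rewrite /z; case: xgetP => [y _ //|].
  by have [y ky] := unb (radius k) => /(_ y); case.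
have [kappa [kge kclose]] := ultra_diagonal Uomega non_principal (close_near w0 hN).
exists (fun i => radius (kappa i)), (fun i => delta (kappa i) *+ 4),
  (fun i => @psi w z N (kappa i) i); split.
- move=> i; split; first by rewrite ltr0n addn_gt0 orbT.
  by rewrite mulrn_wgt0// delta_gt0.
- apply/cvgryPge => c; apply: filterS (near_radius kge c) => i; exact: ltW.
- apply/cvgrPdist_lt => e e0.
  apply: filterS (delta_kappa kge (divr_gt0 e0 (ltr0n R 2))) => i di.
  rewrite sub0r normrN ger0_norm; last by rewrite mulrn_wge0// ltW// delta_gt0.
  by move: di; rewrite ltr_pdivlMr// => di; rewrite (mulrnA _ 2 2) -mulr_natr.
- apply: filterS kclose => i; exact: (psi_weak_approx z w0 hN).
- by move=> phi Cphi; exact: (psi_cvg w0 wd kge kclose z_far Cphi).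
Qed.

End ultralimit_support.

Theorem theorem11p1 (R : realType) (omega : set_system nat)
    (Uomega : UltraFilter omega) (non_principal : forall n, ~ omega [set n])
    (X : nat -> pmetricType R) (X_polish : forall i, polish (X i))
    (m : forall i, {measure set (borel (X i)) -> \bar R})
    (m_finite : forall i, boundedly_finite (m i))
    (m_bounded : asymp_totally_bounded omega m) :
  exists (r e : nat -> R) (psi : forall i, X i -> spt_space Uomega m),
    [/\ forall i, 0 < r i /\ 0 < e i,
        r i @[i --> omega] --> +oo,
        e i @[i --> omega] --> 0,
        \forall i \near omega,
          weak_approx (m i) (mspt Uomega m) (r i) (e i) (psi i) &
        (forall phi : spt_space Uomega m -> R, Cbbs phi ->
           (\int[m i]_(x in ball point (r i)) (phi (psi i x))%:E)%E
             @[i --> omega] --> (\int[mspt Uomega m]_y (phi y)%:E)%E) /\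
        (unbounded_space (spt_space Uomega m) \/ no_mass_escape omega m ->
         forall phi : spt_space Uomega m -> R, Cbbs phi ->
           (\int[m i]_x (phi (psi i x))%:E)%E
             @[i --> omega] --> (\int[mspt Uomega m]_y (phi y)%:E)%E)].
Proof.
have [r [e [psi [re0 rcvg ecvg hpsi hcvg]]]] :=
  weak_approximations Uomega non_principal m_bounded.
exists r, e, psi; split => //; split => [phi /hcvg[]//|hyp phi /hcvg[_]].
exact.
Qed.
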